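(* For all partitions $\lambda,\mu$, \[ \langle G_\lambda(\mathbf x;\boldsymbol\alpha,\boldsymbol\beta),\,g_\mu(\mathbf x;\boldsymbol\alpha,\boldsymbol\beta)\rangle=\delta_{\lambda,\mu}. \]
   Context: Notation: $\boldsymbol\alpha=(\alpha_1,\alpha_2,\dots)$, $\boldsymbol\beta=(\beta_1,\beta_2,\dots)$ are parameters; $A_k=\alpha_1+\dots+\alpha_k$, $B_k=\beta_1+\dots+\beta_k$ for $k\ge1$, $A_k=B_k=0$ for $k\le0$. For a formal $\mathbb Z$-linear combination $Z=\sum_u c_uu$ of variables/parameters, $h_m[Z]$ is defined by $\sum_{m\ge0}h_m[Z]t^m=\prod_u(1-ut)^{-c_u}$, with $h_m[Z]=0$ for $m<0$. For a partition $\lambda$ with at most $n$ parts, \[ G_\lambda(x_1,\dots,x_n;\boldsymbol\alpha,\boldsymbol\beta)=\frac{\det\Big(x_j^{\lambda_i+n-i}\frac{\prod_{k=1}^{i-1}(1-\beta_kx_j)}{\prod_{k=1}^{\lambda_i}(1-\alpha_kx_j)}\Big)_{i,j=1}^n}{\prod_{1\le i<j\le n}(x_i-x_j)},\qquad g_\lambda(x_1,\dots,x_n;\boldsymbol\alpha,\boldsymbol\beta)=\frac{\det\big(h_{\lambda_i+n-i}[x_j-A_{\lambda_i-1}+B_{i-1}]\big)_{i,j=1}^n}{\prod_{1\le i<j\le n}(x_i-x_j)}. \] $G_\lambda(\mathbf x;\boldsymbol\alpha,\boldsymbol\beta)$ (resp. $g_\lambda(\mathbf x;\boldsymbol\alpha,\boldsymbol\beta)$)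 denotes the unique formal power series in $x_1,x_2,\dots$ whose specialization $x_{n+1}=x_{n+2}=\dots=0$ equals $G_\lambda(x_1,\dots,x_n;\boldsymbol\alpha,\boldsymbol\beta)$ (resp. $g_\lambda(x_1,\dots,x_n;\boldsymbol\alpha,\boldsymbol\beta)$) for every $n\ge\ell(\lambda)$; these are (possibly infinite) linear combinations of Schur functions $s_\nu(\mathbf x)$ with coefficients in $\mathbb Z[\boldsymbol\alpha,\boldsymbol\beta]$. $\langle\cdot,\cdot\rangle$ is the Hall inner product $\langle s_\lambda,s_\mu\rangle=\delta_{\lambda,\mu}$, extended bilinearly over the coefficients (the pairing is well defined here since $g_\mu$ is a finite combination of Schur functions). *)

(* Defs.v *)
From HB Require Import structures.
From mathcomp Require Import all_boot all_order all_algebra.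
From mathcomp Require Import finmap boolp classical_sets fsbigop.
From mathcomp Require Export mpoly.

Set Implicit Arguments.
Unset Strict Implicit.
Unset Printing Implicit Defensive.

Import GRing.Theory.

Local Open Scope ring_scope.

Record mpser (R : Type) (n : nat) := MPSer { pcoef : 'X_{1..n} -> R }.

Arguments MPSer {R n} _.
Arguments pcoef {R n} _ _.

HB.instance Definition _ R n := gen_eqMixin (mpser R n).
HB.instance Definition _ R n := gen_choiceMixin (mpser R n).

Lemma mpserP R n (f g : mpser R n) : (forall m, pcoef f m = pcoef g m) -> f = g.
Proof. by case: f g => [f] [g] /= fg; congr MPSer; apply: funext. Qed.

Section PserZmod.
Variables (R : zmodType) (n : nat).
Implicit Types f g h : mpser R n.

Definition pser_zero : mpser R n := MPSer (fun=> 0).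
Definition pser_opp f := MPSer (fun m => - pcoef f m).
Definition pser_add f g := MPSer (fun m => pcoef f m + pcoef g m).

Lemma pser_addA : associative pser_add.
Proof. by move=> f g h; apply: mpserP => m /=; rewrite addrA. Qed.
Lemma pser_addC : commutative pser_add.
Proof. by move=> f g; apply: mpserP => m /=; rewrite addrC. Qed.
Lemma pser_add0 : left_id pser_zero pser_add.
Proof. by move=> f; apply: mpserP => m /=; rewrite add0r. Qed.
Lemma pser_addN : left_inverse pser_zero pser_opp pser_add.
Proof. by move=> f; apply: mpserP => m /=; rewrite addNr. Qed.

HB.instance Definition _ := GRing.isZmodule.Build (mpser R n)
  pser_addA pser_addC pser_add0 pser_addN.
End PserZmod.

Section PserRing.
Variables (R : comNzRingType) (n : nat).
Implicit Types f g h : mpser R n.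

Definition pser_one : mpser R n := MPSer (fun m => (m == 0%MM)%:R).

(* Cauchy product; the index type is large enough to contain every pair of
   exponents with sum [m]. *)
Definition pser_mul f g : mpser R n := MPSer (fun m =>
  \sum_(k : 'X_{1..n < (mdeg m).+1, (mdeg m).+1} | m == (k.1 + k.2)%MM)
     pcoef f k.1 * pcoef g k.2).

Definition ptrunc d f : {mpoly R[n]} :=
  \sum_(m : 'X_{1..n < d}) pcoef f m *: 'X_[m].

Lemma mcoeff_ptrunc d f m : (mdeg m < d)%N -> (ptrunc d f)@_m = pcoef f m.
Proof. exact: mcoeff_mpoly. Qed.

Lemma pcoef_mul d f g m : (mdeg m < d)%N ->
  pcoef (pser_mul f g) m = (ptrunc d f * ptrunc d g)@_m.
Proof.
move=> lt_md; rewrite mcoeffM /=; apply: eq_bigr => k _.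
by rewrite !mcoeff_ptrunc // (leq_trans (bmdeg _)).
Qed.

Lemma mcoeffM_congr d (p p' q q' : {mpoly R[n]}) m : (mdeg m < d)%N ->
    (forall k, (mdeg k < d)%N -> p@_k = p'@_k) ->
    (forall k, (mdeg k < d)%N -> q@_k = q'@_k) ->
  (p * q)@_m = (p' * q')@_m.
Proof.
move=> lt_md pp' qq'; rewrite !mcoeffM; apply: eq_bigr => k _.
by rewrite pp' ?qq' // (leq_trans (bmdeg _)).
Qed.

Lemma pser_mulC : commutative pser_mul.
Proof.
by move=> f g; apply: mpserP => m; rewrite !(@pcoef_mul (mdeg m).+1) // mulrC.
Qed.

Lemma pser_mulA : associative pser_mul.
Proof.
move=> f g h; apply: mpserP => m; set d := (mdeg m).+1.
rewrite (@pcoef_mul d) // (@pcoef_mul d _ h) //.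
transitivity ((ptrunc d f * (ptrunc d g * ptrunc d h))@_m).
  apply: (@mcoeffM_congr d) => // k lt_kd.
  by rewrite mcoeff_ptrunc // (@pcoef_mul d).
rewrite mulrA; apply: (@mcoeffM_congr d) => // k lt_kd.
by rewrite mcoeff_ptrunc // (@pcoef_mul d).
Qed.

Lemma pser_mul1 : left_id pser_one pser_mul.
Proof.
move=> f; apply: mpserP => m; set d := (mdeg m).+1.
rewrite (@pcoef_mul d) //.
transitivity ((1 * ptrunc d f)@_m); last by rewrite mul1r mcoeff_ptrunc.
apply: (@mcoeffM_congr d) => // k lt_kd.
by rewrite mcoeff_ptrunc // mcoeff1.
Qed.

Lemma pser_mulDl : left_distributive pser_mul (@pser_add R n).
Proof.
move=> f g h; apply: mpserP => m /=; rewrite -big_split /=.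
by apply: eq_bigr => k _; rewrite mulrDl.
Qed.

Lemma pser_one_neq0 : pser_one != @pser_zero R n.
Proof.
apply/eqP => /(congr1 (fun f => pcoef f 0%MM)) /= /eqP.
by rewrite eqxx oner_eq0.
Qed.

HB.instance Definition _ := GRing.Zmodule_isComNzRing.Build (mpser R n)
  pser_mulA pser_mulC pser_mul1 pser_mulDl pser_one_neq0.

Definition pser_unit : {pred mpser R n} := fun f => `[< exists g, g * f = 1 >].

Definition pser_inv f : mpser R n :=
  if pser_unit f then xget 0 [set g | g * f = 1] else f.

Lemma pser_mulVx : {in pser_unit, left_inverse 1 pser_inv *%R}.
Proof.
move=> f f_unit; rewrite /pser_inv (f_unit : pser_unit f).
exact: (@xgetPex _ 0 [set g | g * f = 1] (asboolW f_unit)).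
Qed.

Lemma pser_unitPl f g : g * f = 1 -> pser_unit f.
Proof. by move=> gf; apply/asboolP; exists g. Qed.

Lemma pser_inv_out : {in [predC pser_unit], pser_inv =1 id}.
Proof. by move=> f nUf; rewrite /pser_inv ifN //; exact: nUf. Qed.

HB.instance Definition _ := GRing.ComNzRing_hasMulInverse.Build (mpser R n)
  pser_mulVx pser_unitPl pser_inv_out.

Definition pC (c : R) : mpser R n := MPSer (fun m => c *+ (m == 0%MM)).
Definition pX (j : 'I_n) : mpser R n := MPSer (fun m => (m == U_(j)%MM)%:R).

End PserRing.

Arguments pC {R n} c.
Arguments pX {R n} j.

Section Shift.
Variables (R : comNzRingType) (n : nat).
Implicit Types f : mpser R n.

Lemma pcoef_pXM (j : 'I_n) f m :
  pcoef (pX j * f) m = if (U_(j) <= m)%MM then pcoef f (m - U_(j))%MM else 0.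
Proof.
set d := (mdeg m).+1; rewrite (@pcoef_mul _ _ d) //.
rewrite (@mcoeffM_congr _ _ d _ 'X_j _ (ptrunc d f)) //; last first.
  by move=> k lt_kd; rewrite mcoeff_ptrunc // mcoeffX eq_sym.
rewrite mulrC; case: ifP => [le_jm | nle_jm].
  have := mcoeffMX (ptrunc d f) U_(j)%MM (m - U_(j))%MM.
  rewrite addmC submK // => ->; rewrite mcoeff_ptrunc //.
  by rewrite ltnS mdegB.
rewrite mcoeffMr big1 // => k /eqP def_m.
rewrite mcoeffX; case: eqP => [jk|]; last by rewrite mulr0.
have : (U_(j) <= k.1 + k.2)%MM by rewrite jk lem_addr.
by rewrite -def_m nle_jm.
Qed.

Lemma pcoef_pCM (c : R) f m : pcoef (pC c * f) m = c * pcoef f m.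
Proof.
set d := (mdeg m).+1; rewrite (@pcoef_mul _ _ d) //.
rewrite (@mcoeffM_congr _ _ d _ c%:MP _ (ptrunc d f)) //; last first.
  by move=> k lt_kd; rewrite mcoeff_ptrunc // mcoeffC mulr_natr.
by rewrite mcoeffCM mcoeff_ptrunc.
Qed.

(* Hence [(1 - pC c * pX j)^-1] is a true inverse, not a default value. *)
Lemma unit_one_subX (c : R) (j : 'I_n) : 1 - pC c * pX j \is a GRing.unit.
Proof.
pose g := MPSer (fun m => if m == (U_(j) *+ m j)%MM then c ^+ m j else 0).
apply/asboolP; exists g; rewrite mulrC mulrBl mul1r -mulrA.
apply: mpserP => m; rewrite [LHS](_ : _ = pcoef g m - pcoef (pC c * (pX j * g)) m) //.
rewrite pcoef_pCM pcoef_pXM /=.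
case: (boolP (U_(j) <= m)%MM) => [le_jm | nle_jm]; last first.
  have m_j0 : m j = 0%N.
    by apply/eqP; rewrite -[_ == _]negbK -lep1mP.
  by rewrite m_j0 mulm0n mulr0 subr0 expr0; case: eqP.
move: (submK le_jm); set k := (m - U_(j))%MM => <-.
rewrite mnmDE mnm1E eqxx addn1 mulmS [(k + _)%MM]addmC eqm_add2l.
rewrite [(_ == 0%MM)](_ : _ = false); last first.
  by apply/negbTE; rewrite -mdeg_eq0 mdegD mdeg1.
by case: eqP => _; rewrite ?exprS ?mulr0 subrr.
Qed.
End Shift.

(* The quotient [F / D] of two power series, where [D] is not assumed to be
   invertible; it is unique as soon as [D] is not a zero divisor. *)
Definition pser_div (R : comNzRingType) n (F D : mpser R n) : mpser R n :=
  xget 0 [set Q | Q * D = F].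

Record intpart := IntPart {
  parts :> seq nat;
  _ : sorted geq parts && (0%N \notin parts)
}.

HB.instance Definition _ := [isSub for parts].
HB.instance Definition _ := [Countable of intpart by <:].

(* [part lam i] is the part of index [i + 1], and 0 beyond the length. *)
Definition part (lam : intpart) (i : nat) : nat := nth 0%N lam i.

(* [Z] lists the pairs [(c_u, u)]; the extra variable [t] is [pX ord0]. *)
Definition hgen (K : comNzRingType) (Z : seq (int * K)) : mpser K 1 :=
  \prod_(p <- Z) (1 - pC p.2 * pX ord0) ^ (- p.1).

Definition hsym (K : comNzRingType) (m : nat) (Z : seq (int * K)) : K :=
  pcoef (hgen Z) [multinom m | _ < 1].

Section FiniteVariables.
Variables (R : comNzRingType) (n : nat).

Definition vandermonde : mpser R n :=
  \prod_(i < n) \prod_(j < n | (i < j)%N) (pX i - pX j).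

Definition schur_fin (lam : intpart) : mpser R n :=
  pser_div (\det (\matrix_(i < n, j < n) pX j ^+ (part lam i + (n.-1 - i))))
           vandermonde.

(* Parameters are indexed from 1: [alpha k] is the k-th one and [alpha 0] is
   never used. Rows are indexed from 0, so that the row index of the usual
   formula is [i.+1]. *)
Variables alpha beta : nat -> R.

Definition Gfin (lam : intpart) : mpser R n :=
  pser_div
    (\det (\matrix_(i < n, j < n)
       (pX j ^+ (part lam i + (n.-1 - i))
        * \prod_(1 <= k < i.+1) (1 - pC (beta k) * pX j)
        / \prod_(1 <= k < (part lam i).+1) (1 - pC (alpha k) * pX j))))
    vandermonde.

(* [x_j - A_a + B_b] as a formal combination. *)
Definition galphabet (j : 'I_n) (a b : nat) : seq (int * mpser R n) :=
  (1, pX j) :: [seq (- 1, pC (alpha k)) | k <- iota 1 a]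
            ++ [seq (1, pC (beta k)) | k <- iota 1 b].

(* For a zero part, [(part lam i).-1 = 0] and [A_0 = A_(-1) = 0]. *)
Definition gfin (lam : intpart) : mpser R n :=
  pser_div
    (\det (\matrix_(i < n, j < n)
       hsym (part lam i + (n.-1 - i)) (galphabet j (part lam i).-1 i)))
    vandermonde.

End FiniteVariables.

(* The variables are [x_0, x_1, ...]. *)
Definition series (R : Type) := {fsfun nat -> nat with 0%N} -> R.

Definition extend_mnm n (m : 'X_{1..n}) : {fsfun nat -> nat with 0%N} :=
  [fsfun k in [fset i in iota 0 n]%fset => nth 0%N m k].

(* Setting all variables but the first [n] ones to 0. *)
Definition specialize (R : Type) n (F : series R) : mpser R n :=
  MPSer (fun m => F (extend_mnm m)).

(* The series whose specialization to [n] variables is [f n] for [n >= l]. *)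
Definition stable_series (R : comNzRingType) (l : nat)
    (f : forall n, mpser R n) : series R :=
  xget (fun=> 0) [set F | forall n, (l <= n)%N -> specialize n F = f n].

Section InfiniteVariables.
Variable R : comNzRingType.

Definition schur (lam : intpart) : series R :=
  stable_series (size lam) (fun n => schur_fin R n lam).

Definition Gseries (alpha beta : nat -> R) (lam : intpart) : series R :=
  stable_series (size lam) (fun n => Gfin n alpha beta lam).

Definition gseries (alpha beta : nat -> R) (lam : intpart) : series R :=
  stable_series (size lam) (fun n => gfin n alpha beta lam).

(* [F] is the possibly infinite combination of the [schur nu] with
   coefficients [a]. As [schur nu] is homogeneous of degree [|nu|], the sum is
   finite at every monomial. *)
Definition schur_expansion (F : series R) (a : intpart -> R) : Prop :=
  forall m, F m = \sum_(nu \in [set: intpart]) a nu * schur nu m.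

Definition schur_coef (F : series R) : intpart -> R :=
  xget (fun=> 0) [set a | schur_expansion F a].

(* The bilinear extension of [<s_lam, s_mu> = delta], meant for a pair of
   series one of which is a finite combination of Schur functions. *)
Definition hall (F H : series R) : R :=
  \sum_(nu \in [set: intpart]) schur_coef F nu * schur_coef H nu.

End InfiniteVariables.

(* Main.v *)
(* The complete homogeneous symmetric polynomials satisfy linear relations
   obtained by removing variables one at a time; in matrix form they give the
   Jacobi-Trudi formula, hence stability of the Schur polynomials and their
   vanishing when there are fewer variables than parts.  If row [i] of an
   alternant-like determinant is [f_i(x_j)] for a univariate power series [f_i],
   the Cauchy-Binet formula expands it into Schur functions, the coefficients
   being minors of the matrix of coefficients of the [f_i].  This applies to G
   and to g, and a second use of Cauchy-Binet turns the Hall product into a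
   single determinant.  Its entry [(i, j)] is the coefficient of
   [x^(mu_j - j - lam_i + i)] in
     prod_(k <= i) (1 - beta_k x) prod_(k < mu_j) (1 - alpha_k x)
     / (prod_(k <= lam_i) (1 - alpha_k x) prod_(k <= j) (1 - beta_k x)).
   The entry vanishes when [i <= j] and [mu_j <= lam_i], except for the ones
   occurring at [i = j], [mu_j = lam_i], because the exponent is negative, and
   when [j <= i] and [lam_i < mu_j], because the quotient is a polynomial of
   degree below the exponent.  So the matrix is unitriangular if [lam = mu], and
   has a zero block too large for a nonzero determinant otherwise. *)

From HB Require Import structures.
Require Import Defs.
From mathcomp Require Import finmap boolp classical_sets fsbigop.
From mathcomp Require Import all_boot all_order all_fingroup all_algebra zify.

Set Implicit Arguments.
Unset Strict Implicit.
Unset Printing Implicit Defensive.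

Import GRing.Theory.

Local Open Scope ring_scope.

(** * Equality of power series up to a degree, and cancellation of the Vandermonde product *)

Section Series.
Variables (R : comNzRingType) (n : nat).
Implicit Types (f g : mpser R n) (m : 'X_{1..n}).

Lemma pcoefD f g m : pcoef (f + g) m = pcoef f m + pcoef g m.
Proof. by []. Qed.

Lemma pcoefB f g m : pcoef (f - g) m = pcoef f m - pcoef g m.
Proof. by []. Qed.

Lemma pcoef_sum I (r : seq I) (P : pred I) (F : I -> mpser R n) m :
  pcoef (\sum_(i <- r | P i) F i) m = \sum_(i <- r | P i) pcoef (F i) m.
Proof. by elim/big_rec2: _ => // i y x _ <-. Qed.

Lemma pC_is_zmod_morphism : zmod_morphism (@pC R n).
Proof. by move=> a b; apply: mpserP => m /=; rewrite mulrnBl. Qed.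

Lemma pC_is_monoid_morphism : monoid_morphism (@pC R n).
Proof.
split=> [|a b]; first exact: mpserP.
by apply: mpserP => m; rewrite pcoef_pCM /= -mulrnAr.
Qed.

HB.instance Definition _ :=
  GRing.isZmodMorphism.Build R (mpser R n) (@pC R n) pC_is_zmod_morphism.
HB.instance Definition _ :=
  GRing.isMonoidMorphism.Build R (mpser R n) (@pC R n) pC_is_monoid_morphism.

(** Agreement modulo total degree [N]: infinite expansions in the [x_j] are compared through finite
    truncations. *)
Definition eqd N f g := forall m, (mdeg m < N)%N -> pcoef f m = pcoef g m.

Lemma eqd_trans N f g h : eqd N f g -> eqd N g h -> eqd N f h.
Proof. by move=> fg gh m lt_m; rewrite fg ?gh. Qed.

Lemma eqd_eq f g : (forall N, eqd N f g) -> f = g.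
Proof. by move=> fg; apply: mpserP => m; apply: (fg (mdeg m).+1). Qed.

Lemma eqdD N f f' g g' : eqd N f f' -> eqd N g g' -> eqd N (f + g) (f' + g').
Proof. by move=> ff gg m lt_m; rewrite !pcoefD ff ?gg. Qed.

Lemma eqdM N f f' g g' : eqd N f f' -> eqd N g g' -> eqd N (f * g) (f' * g').
Proof.
move=> ff gg m lt_m.
rewrite (@pcoef_mul _ _ N f g) // (@pcoef_mul _ _ N f' g') //.
by apply: (@mcoeffM_congr _ _ N) => // k lt_k; rewrite !mcoeff_ptrunc ?ff ?gg.
Qed.

Lemma eqd_sum I (r : seq I) (P : pred I) N (F G : I -> mpser R n) :
  (forall i, P i -> eqd N (F i) (G i)) ->
  eqd N (\sum_(i <- r | P i) F i) (\sum_(i <- r | P i) G i).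
Proof. by move=> FG; elim/big_ind2: _ => // *; apply: eqdD. Qed.

Lemma eqd_prod I (r : seq I) (P : pred I) N (F G : I -> mpser R n) :
  (forall i, P i -> eqd N (F i) (G i)) ->
  eqd N (\prod_(i <- r | P i) F i) (\prod_(i <- r | P i) G i).
Proof. by move=> FG; elim/big_ind2: _ => // *; apply: eqdM. Qed.

Lemma eqd_det N p (A B : 'M[mpser R n]_p) :
  (forall i j, eqd N (A i j) (B i j)) -> eqd N (\det A) (\det B).
Proof.
move=> AB; apply: eqd_sum => s _; apply: eqdM => //.
exact: eqd_prod.
Qed.

Lemma pcoef_expX (j : 'I_n) k m :
  pcoef (pX j ^+ k : mpser R n) m = (m == (U_(j) *+ k)%MM)%:R.
Proof.
elim: k m => [|k IHk] m; first by rewrite expr0 mulm0n.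
rewrite exprS pcoef_pXM; case: ifP => [le_jm | nle_jm].
  rewrite IHk mulmS; congr (_ %:R); congr (nat_of_bool _).
  by rewrite -{2}(submK le_jm) addmC eqm_add2l.
case: eqP => // def_m; case/idP: nle_jm.
by rewrite def_m mulmS lem_addr.
Qed.

(** If [x_i f = x_j f], the coefficients of [f] at [m] and at [m + U_(i) - U_(j)] agree; repeating
    the move exhausts the exponent of [x_j], and then the coefficient is 0. *)
Lemma lreg_pXB (i j : 'I_n) : i != j -> GRing.lreg (pX i - pX j : mpser R n).
Proof.
move=> ne_ij; apply: mulrI0_lreg => f f0; apply: mpserP => m.
have [k] := ubnP (m j); elim: k m => // k IHk m lt_m.
have := congr1 (fun g => pcoef g (m + U_(i))%MM) f0.
rewrite mulrBl pcoefB !pcoef_pXM lem_addl // addmK /= => /eqP.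
rewrite subr_eq0 => /eqP ->; case: ifP => // le_j; apply: IHk.
have: ((m + U_(i))%MM j != 0)%N by rewrite -lep1mP.
rewrite mnmBE mnmDE !mnm1E eqxx (negPf ne_ij) addn0 subn1 => m_j.
by rewrite -ltnS prednK // lt0n.
Qed.

Lemma lreg_vandermonde : GRing.lreg (vandermonde R n).
Proof.
rewrite /vandermonde; elim/big_ind: _ => [||i _].
- exact: lreg1.
- by move=> f g; apply: lregM.
elim/big_ind: _ => [||j lt_ij].
- exact: lreg1.
- by move=> f g; apply: lregM.
by apply: lreg_pXB; rewrite neq_ltn lt_ij.
Qed.

Lemma pser_div_vandermonde F Q :
  Q * vandermonde R n = F -> pser_div F (vandermonde R n) = Q.
Proof.
move=> QV; rewrite /pser_div; case: xgetP => [Q' _ /= Q'V | /(_ Q)//].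
by apply: lreg_vandermonde; rewrite mulrC Q'V -QV mulrC.
Qed.

(** * Complete homogeneous polynomials and the Jacobi-Trudi determinant *)

Definition hvar (A : pred 'I_n) k : mpser R n :=
  MPSer (fun m => ((mdeg m == k) && [forall i, (m i != 0%N) ==> A i])%:R).

(** This is [h_(p-q)] in the variables of [A]. Keeping [p] and [q] apart gives 0 for a negative
    index, where truncated subtraction would give [h_0 = 1]. *)
Definition hdiff A p q : mpser R n := if (q <= p)%N then hvar A (p - q)%N else 0.

Lemma hvar0 A : hvar A 0 = 1.
Proof.
apply: mpserP => m /=; rewrite mdeg_eq0; case: eqP => // ->.
by case: forallP => // -[] i; rewrite mnm0E.
Qed.

Lemma hdiff_del (A : pred 'I_n) i p q : A i ->
  hdiff [predD1 A & i] p q = hdiff A p q - pX i * hdiff A p q.+1.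
Proof.
rewrite /hdiff => Ai; case: (ltngtP q p) => [lt_qp | _ | ->]; last first.
- by rewrite subnn !hvar0 mulr0 subr0.
- by rewrite mulr0 subr0.
move: (p - q.+1)%N (subnSK lt_qp) => k <-.
apply: mpserP => m; rewrite pcoefB pcoef_pXM /=; case: ifPn => [le_m | nle_m].
  move: (submK le_m); set m' := (m - U_(i))%MM => <-.
  rewrite mdegD mdeg1 addn1 eqSS; case: (_ == k) => /=; last by rewrite subrr.
  have -> : [forall x, ((m' + U_(i))%MM x != 0%N) ==> [predD1 A & i] x] = false.
    apply/forallP => /(_ i); by rewrite mnmDE mnm1E eqxx addn1 /= eqxx.
  suff -> : [forall x, ((m' + U_(i))%MM x != 0%N) ==> A x]
          = [forall x, (m' x != 0%N) ==> A x] by rewrite subrr.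
  apply: eq_forallb => x; rewrite mnmDE mnm1E.
  by case: (eqVneq i x) => [<- | _]; rewrite ?addn0 // Ai !implybT.
rewrite subr0; congr (_ && _)%:R; apply: eq_forallb => x.
rewrite /=; case: (eqVneq x i) => [->|_] //=.
by move: nle_m; rewrite lep1mP negbK => /eqP ->.
Qed.

(* Iterating [hdiff_del] multiplies the generating function of the [h_k] by the
   linear factors of the removed variables. *)
Lemma hdiff_delete (r : seq 'I_n) : uniq r ->
  exists c : nat -> mpser R n, c 0%N = 1 /\
    forall p q, hdiff [pred x | x \notin r] p q
              = \sum_(k < (size r).+1) c k * hdiff predT p (q + k)%N.
Proof.
elim: r => [_ | i r IHr /= /andP[i_r /IHr[c [c0 def_c]]]].
  exists (fun=> 1); split=> // p q.
  by rewrite big_ord1 addn0 mul1r.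
exists (fun k => (if (k <= size r)%N then c k else 0)
               - (if k is k'.+1 then pX i * c k' else 0)).
split=> [|p q]; first by rewrite subr0.
transitivity (hdiff [predD1 [pred x | x \notin r] & i] p q).
  rewrite /hdiff; case: ifP => // _; apply: mpserP => m /=.
  congr (_ && _)%:R; apply: eq_forallb => x; congr (_ ==> _).
  by rewrite /= !inE negb_or.
rewrite hdiff_del // !def_c; under [RHS]eq_bigr do rewrite mulrBl.
rewrite big_split sumrN /=; congr (_ - _).
  rewrite [RHS]big_ord_recr /= ltnn mul0r addr0.
  by apply: eq_bigr => k _; rewrite -ltnS ltn_ord.
rewrite [RHS]big_ord_recl /= mul0r add0r mulr_sumr.
by apply: eq_bigr => k _; rewrite mulrA addnS addSn.
Qed.

Definition jacobi_trudi (nu : intpart) p :=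
  \det (\matrix_(i < p, j < p) hdiff predT (part nu i + j)%N i).

Definition alternant (nu : intpart) : mpser R n :=
  \det (\matrix_(i < n, j < n) pX j ^+ (part nu i + (n.-1 - i))%N).

Lemma hdiff_eq A p q p' q' : (p + q' = p' + q)%N -> hdiff A p q = hdiff A p' q'.
Proof.
move=> e; rewrite /hdiff; have -> : (q' <= p')%N = (q <= p)%N by lia.
by case: ifP => // le_qp; congr hvar; lia.
Qed.

Lemma expX_hdiff (j : 'I_n) k :
  hdiff [pred x | x \notin rem j (enum 'I_n)] k 0 = pX j ^+ k.
Proof.
rewrite /hdiff subn0; apply: mpserP => m; rewrite pcoef_expX /=.
congr ((nat_of_bool _)%:R).
have inr x : (x \notin rem j (enum 'I_n)) = (x == j).
  by rewrite mem_rem_uniq ?enum_uniq // !inE mem_enum andbT negbK.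
apply/andP/eqP => [[/eqP dm /forallP mj] | ->].
  have m0 i : i != j -> m i = 0%N.
    by move=> ne; move: (mj i); rewrite /= inr (negPf ne) implybF negbK => /eqP.
  apply/mnmP => i; rewrite mulmnE mnm1E; case: (eqVneq j i) => [<-|ne].
    by rewrite mul1n -dm mdegE (bigD1 j) //= big1 ?addn0 // => x /m0.
  by rewrite mul0n m0 // eq_sym.
rewrite mdegMn mdeg1 mul1n; split=> //; apply/forallP => i; rewrite /= inr.
by rewrite mulmnE mnm1E; case: (eqVneq j i) => _; rewrite ?implybT.
Qed.

(** Each [x_j ^+ p] is a combination of the [h_(p-k)] with [k < n], with coefficients independent of
    [p]; so the alternant matrix is the Jacobi-Trudi matrix times a matrix independent of [nu]. The
    empty partition later reveals the value of [e]. *)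
Lemma alternant_factor : exists e : mpser R n,
  forall nu, alternant nu = jacobi_trudi nu n * e.
Proof.
have /fin_all_exists[c def_c] (j : 'I_n) : exists c : nat -> mpser R n,
    forall p, pX j ^+ p = \sum_(k < n) c k * hdiff predT p k.
  have [c [_ def_c]] := hdiff_delete (rem_uniq j (enum_uniq 'I_n)).
  exists c => p; rewrite -expX_hdiff def_c size_rem ?mem_enum // size_enum_ord.
  by rewrite prednK ?(leq_trans _ (ltn_ord j)).
exists (\det (\matrix_(i, j) c j (n.-1 - i)%N)) => nu.
rewrite -det_mulmx; congr (\det _); apply/matrixP => i j; rewrite !mxE def_c.
rewrite (reindex_inj rev_ord_inj); apply: eq_bigr => k _; rewrite !mxE mulrC.
have -> : rev_ord k = (n.-1 - k)%N :> nat by rewrite /= -subn1 -subnDA add1n.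
congr (_ * _); apply: hdiff_eq.
have lt_i := ltn_ord i; have lt_k := ltn_ord k.
by lia.
Qed.
End Series.

(** * Determinants with prescribed zeros *)

Section DetLemmas.
Variable S : comNzRingType.

(** From row [l] on the matrix is lower unitriangular, so expanding along the last row removes one
    row and one column at a time. *)
Lemma det_stable (M : nat -> nat -> S) l p : (l <= p)%N ->
    (forall i j, (l <= i)%N -> (j <= i)%N -> M i j = (i == j)%:R) ->
  \det (\matrix_(i < p, j < p) M i j) = \det (\matrix_(i < l, j < l) M i j).
Proof.
move=> + unitri; elim: p => [|p IHp]; first by rewrite leqn0 => /eqP ->.
rewrite leq_eqVlt ltnS => /orP[/eqP -> // | le_lp]; rewrite -IHp //.
rewrite (expand_det_row _ ord_max) big_ord_recr /= big1 ?add0r => [|j _].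
  rewrite mxE unitri //= eqxx mul1r /cofactor addnn -signr_odd odd_double mul1r.
  by congr (\det _); apply/matrixP => i j; rewrite !mxE !lift_max.
rewrite mxE unitri //=; last exact: ltnW.
by rewrite gtn_eqF ?mul0r.
Qed.

(** Pigeonhole: no permutation sends the [p - k] rows from [k] on into the [p - k - 1] columns after
    [k], so each term of the determinant has a factor in the zero block. *)
Lemma det_zero_block p (M : 'M[S]_p) (k : 'I_p) :
  (forall i j : 'I_p, (k <= i)%N -> (j <= k)%N -> M i j = 0) -> \det M = 0.
Proof.
move=> M0; rewrite /determinant big1 // => s _.
suff [i le_ki le_sk] : exists2 i : 'I_p, (k <= i)%N & (s i <= k)%N.
  by rewrite (bigD1 i) //= M0 // mul0r mulr0.
apply/exists_inP; apply: contraT; rewrite negb_exists_in => /forall_inP gt_k.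
have sub : s @: [set i : 'I_p | (k <= i)%N] \subset [set i : 'I_p | (k < i)%N].
  by apply/subsetP => _ /imsetP[i + ->]; rewrite !inE => /gt_k; rewrite ltnNge.
have := subset_leq_card sub; rewrite card_imset; last exact: perm_inj.
have -> : [set i : 'I_p | (k <= i)%N] = k |: [set i : 'I_p | (k < i)%N].
  by apply/setP => i; rewrite !inE leq_eqVlt eq_sym.
by rewrite cardsU1 inE ltnn add1n ltnn.
Qed.

End DetLemmas.

(** * Partitions and strictly decreasing exponent sequences *)

Section Partitions.
Implicit Types nu : intpart.

Lemma geq_trans : transitive geq.
Proof. by move=> x y z /= xy yz; apply: leq_trans yz xy. Qed.

Lemma part_gt0 nu i : (0 < part nu i)%N = (i < size nu)%N.
Proof.
case: (ltnP i (size nu)) => [lt_i | ge_i]; last by rewrite /part nth_default.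
have /andP[_ nu0] := valP nu.
by rewrite lt0n; apply: contraNneq nu0 => nu_i; rewrite -{1}nu_i mem_nth.
Qed.

Lemma part_default nu i : (size nu <= i)%N -> part nu i = 0%N.
Proof. exact: nth_default. Qed.

Lemma part_le nu i j : (i <= j)%N -> (part nu j <= part nu i)%N.
Proof.
move=> le_ij; have /andP[nu_s _] := valP nu.
case: (ltnP j (size nu)) => [lt_j | ge_j]; last by rewrite part_default.
by apply: (sorted_leq_nth geq_trans leqnn 0%N nu_s) => //; apply: leq_ltn_trans lt_j.
Qed.

Lemma part_inj nu nu' : part nu =1 part nu' -> nu = nu'.
Proof.
move=> eq_nu; apply: val_inj; apply: (@eq_from_nth _ 0%N) => [|i _]; last exact: eq_nu.
have size_le a b : part a =1 part b -> (size a <= size b)%N.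
  by move=> eq_ab; rewrite leqNgt -part_gt0 eq_ab part_gt0 ltnn.
by apply/eqP; rewrite eqn_leq !size_le.
Qed.

(** The exponents of the alternant. The shift makes them strictly decreasing, so partitions of
    length at most [n] encode [n]-element sets of exponents. *)
Definition staircase n nu i := (part nu i + (n.-1 - i))%N.

Lemma staircase_lt n nu i j :
  (i < j)%N -> (j < n)%N -> (staircase n nu j < staircase n nu i)%N.
Proof. by rewrite /staircase => lt_ij lt_jn; have := part_le nu (ltnW lt_ij); lia. Qed.

Definition staircase_seq n nu := [seq staircase n nu i | i <- iota 0 n].

Lemma staircase_sorted n nu : sorted gtn (staircase_seq n nu).
Proof.
apply/(sortedP 0%N) => i; rewrite size_map size_iota => lt_i.
rewrite !(nth_map 0%N) ?size_iota ?(ltnW lt_i) // !nth_iota ?(ltnW lt_i) //.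
exact: staircase_lt.
Qed.

Lemma staircase_inj n nu nu' : (size nu <= n)%N -> (size nu' <= n)%N ->
  (forall i, (i < n)%N -> staircase n nu i = staircase n nu' i) -> nu = nu'.
Proof.
move=> le_nu le_nu' eq_s; apply: part_inj => i.
case: (ltnP i n) => [/eq_s/addIn // | le_ni].
by rewrite !part_default ?(leq_trans _ le_ni).
Qed.

(** Both sequences are strictly decreasing with the same set of values, so sorting identifies them;
    then [s] fixes every index because the values are distinct. *)
Lemma staircase_perm n nu nu' (s : 'S_n) :
  (size nu <= n)%N -> (size nu' <= n)%N ->
  (forall i : 'I_n, staircase n nu i = staircase n nu' (s i)) ->
  nu = nu' /\ s = 1%g.
Proof.
move=> le_nu le_nu' eq_s.
have eq_nu : nu = nu'.
  apply: (@staircase_inj n) => // i lt_i.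
  have eq_seq : staircase_seq n nu = staircase_seq n nu'.
    apply: (@irr_sorted_eq _ gtn); rewrite ?staircase_sorted //.
    - by move=> x y z /= xy yz; apply: ltn_trans yz xy.
    - by move=> x; apply: ltnn.
    move=> x; rewrite /staircase_seq -!val_enum_ord -!map_comp.
    apply/mapP/mapP => -[k _ ->].
      by exists (s k); rewrite ?mem_enum //; apply: eq_s.
    by exists (s^-1 k)%g; rewrite ?mem_enum //; rewrite /= eq_s permKV.
  have := congr1 (nth 0%N ^~ i) eq_seq.
  by rewrite !(nth_map 0%N) ?size_iota // nth_iota.
split=> //; apply/permP => i; rewrite perm1; apply/val_inj/eqP.
move: (eq_s i); rewrite eq_nu => e.
case: (ltngtP (s i) i) => // lt_si.
  by have := @staircase_lt n nu' _ _ lt_si (ltn_ord _); rewrite e ltnn.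
by have := @staircase_lt n nu' _ _ lt_si (ltn_ord _); rewrite e ltnn.
Qed.

End Partitions.

(** * The Jacobi-Trudi formula and the coefficients of alternants *)

Section Alternants.
Variables (R : comNzRingType) (n : nat).
Implicit Types (nu : intpart) (m : 'X_{1..n}).

Lemma jacobi_trudi_stable nu p : (size nu <= p)%N ->
  jacobi_trudi R n nu p = jacobi_trudi R n nu (size nu).
Proof.
move=> le_nu; rewrite /jacobi_trudi.
pose M i j := hdiff R (predT : pred 'I_n) (part nu i + j)%N i.
apply: (@det_stable _ M) => // i j le_i le_ji.
rewrite /M part_default // add0n /hdiff; move: le_ji; rewrite leq_eqVlt.
case/predU1P => [-> | lt_ji]; first by rewrite leqnn subnn hvar0 eqxx.
by rewrite leqNgt lt_ji gtn_eqF.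
Qed.

Lemma alternant0 nu : size nu = 0%N -> alternant R n nu = vandermonde R n.
Proof.
move=> nu0.
(* The variables are reversed because [det_Vandermonde] puts the larger index first in each factor;
   reversing rows and columns together costs no sign. *)
set V := Vandermonde n (\row_(j < n) pX (rev_ord j) : 'rV[mpser R n]_n).
transitivity (\det V).
  pose p := perm (@rev_ord_inj n).
  transitivity (\det (row_perm p (col_perm p V))).
    congr (\det _); apply/matrixP => i j; rewrite !mxE !permE rev_ordK.
    by rewrite part_default ?nu0 //= add0n -subn1 -subnDA add1n.
  rewrite row_permE col_permE !det_mulmx !det_perm odd_permV mulrC -mulrA.
  by rewrite -signr_addb addbb mulr1.
rewrite det_Vandermonde /vandermonde (reindex_inj rev_ord_inj) /=.
under eq_bigr do rewrite (reindex_inj rev_ord_inj) /=.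
rewrite (exchange_big_dep predT) //=; apply: eq_bigr => i _.
apply: eq_big => [j | j _]; rewrite ?mxE ?rev_ordK //=.
by have := ltn_ord i; have := ltn_ord j; lia.
Qed.

(** The factor [e] of [alternant_factor] is the same for all [nu], and the empty partition, whose
    Jacobi-Trudi determinant is 1, identifies it. *)
Lemma alternantE nu : (size nu <= n)%N ->
  alternant R n nu = jacobi_trudi R n nu (size nu) * vandermonde R n.
Proof.
have [e def_e] := alternant_factor R n => le_nu.
have nil_ok : sorted geq [::] && (0%N \notin [::]) by [].
have := def_e (IntPart nil_ok); rewrite alternant0 // jacobi_trudi_stable //.
rewrite {1}/jacobi_trudi /= det_mx00 mul1r => ->.
by rewrite def_e jacobi_trudi_stable.
Qed.

(** Removing all [n] variables gives a linear relation between the columns, since complete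
    homogeneous polynomials in no variables vanish in positive degree. The adjugate turns this
    kernel vector, which has an entry 1, into the vanishing of the determinant. *)
Lemma jacobi_trudi_eq0 nu : (n < size nu)%N -> jacobi_trudi R n nu (size nu) = 0.
Proof.
move=> lt_n; set l := size nu in lt_n *.
have [c [c0 def_c]] := @hdiff_delete R n _ (enum_uniq 'I_n).
(* The relation has [n + 1] coefficients, which fit into the [l > n] columns; [c 0 = 1] becomes the
   last entry. *)
pose v : 'cV[mpser R n]_l := \col_j (if (l.-1 - j <= n)%N then c (l.-1 - j)%N else 0).
pose M := \matrix_(i < l, j < l) hdiff R (predT : pred 'I_n) (part nu i + j)%N i.
have Mv : M *m v = 0.
  apply/matrixP => i k; rewrite !mxE.
  transitivity (hdiff R [pred x | x \notin enum 'I_n] (part nu i + l.-1)%N i).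
    rewrite def_c size_enum_ord (reindex_inj rev_ord_inj).
    rewrite (big_ord_widen l (fun k => c k * hdiff R predT (part nu i + l.-1)%N (i + k)%N)) //.
    rewrite [RHS]big_mkcond; apply: eq_bigr => j _; rewrite !mxE /=.
    have lt_j := ltn_ord j; have -> : (l.-1 - (l - j.+1) = j)%N by lia.
    rewrite ltnS; case: leqP => _; last by rewrite mulr0.
    by rewrite mulrC; congr (_ * _); apply: hdiff_eq; lia.
  have := part_gt0 nu i; rewrite ltn_ord => nu_i; have lt_i := ltn_ord i.
  rewrite /hdiff; have -> : (i <= part nu i + l.-1)%N by lia.
  apply: mpserP => m /=; case: eqP => //= mdeg_m; case: forallP => // m0.
  suff m_eq0 : mdeg m = 0%N by lia.
  rewrite mdegE big1 // => j _; apply/eqP; apply: contraT => mj.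
  by have := m0 j; rewrite mj mem_enum.
have := congr1 (mulmx (\adj M)) Mv.
rewrite mulmxA mul_adj_mx mul_scalar_mx mulmx0 => /matrixP.
have lt_l : (l.-1 < l)%N by lia.
move/(_ (Ordinal lt_l) 0); rewrite !mxE /= subnn c0 mulr1; by [].
Qed.

(** The first row consists of the [h_(nu_0 + j)]. Once the length is bounded, this leaves finitely
    many partitions below a given degree. *)
Lemma jacobi_trudi_low nu :
  eqd (part nu 0) (jacobi_trudi R n nu (size nu)) 0.
Proof.
case: (posnP (size nu)) => [/eqP | nu_gt0]; first by rewrite size_eq0 /part => /eqP ->.
rewrite /jacobi_trudi (expand_det_row _ (Ordinal nu_gt0)).
move=> m lt_m; rewrite pcoef_sum big1 // => j _.
set A := cofactor _ _ _.
rewrite (@eqdM _ _ (part nu 0) _ 0 _ A) ?mul0r // {A} => k lt_k.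
 rewrite mxE /hdiff /= subn0.
by rewrite ltn_eqF //=; lia.
Qed.

Lemma pcoef_prodX (k : 'X_{1..n}) m :
  pcoef (\prod_(j < n) pX j ^+ k j : mpser R n) m = (m == k)%:R.
Proof.
pose F (p : {mpoly R[n]}) : mpser R n := MPSer (fun m => p@_m).
have FM : {morph F : p q / p * q}.
  move=> p q; apply: mpserP => m'; rewrite (@pcoef_mul _ _ (mdeg m').+1 (F p) (F q)) //.
  by apply: (@mcoeffM_congr _ _ (mdeg m').+1) => // x lt_x; rewrite mcoeff_ptrunc.
have F1 : F 1 = 1 by apply: mpserP => m' /=; rewrite mcoeff1.
have FX j : F 'X_j = pX j by apply: mpserP => m' /=; rewrite mcoeffX eq_sym.
transitivity (pcoef (F 'X_[k]) m); last by rewrite /= mcoeffX eq_sym.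
rewrite mpolyXE_id (big_morph F FM F1); congr (pcoef _ m); apply: eq_bigr => j _.
by rewrite -FX; elim: (k j) => [|p IHp]; rewrite ?expr0 ?F1 // !exprS FM IHp.
Qed.

(** Only the identity permutation produces strictly decreasing exponents. Reading such coefficients
    is what separates the Schur functions later. *)
Lemma pcoef_alternant nu nu' : (size nu <= n)%N -> (size nu' <= n)%N ->
  pcoef (alternant R n nu) [multinom staircase n nu' j | j < n] = (nu == nu')%:R.
Proof.
move=> le_nu le_nu'; rewrite /alternant /determinant pcoef_sum.
have coefE (s : 'S_n) :
    pcoef (\prod_i (\matrix_(i < n, j < n)
              pX j ^+ (part nu i + (n.-1 - i))%N : 'M[mpser R n]_n) i (s i))
          [multinom staircase n nu' j | j < n]
    = ([multinom staircase n nu' j | j < n]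
       == [multinom staircase n nu (s^-1 j)%g | j < n])%:R.
  rewrite -pcoef_prodX; congr pcoef; rewrite [RHS](reindex_inj (@perm_inj _ s)).
  by apply: eq_bigr => i _; rewrite !mxE mnmE permK.
have signE (s : 'S_n) f m : pcoef ((-1) ^+ s * f : mpser R n) m = (-1) ^+ s * pcoef f m.
  by rewrite -(rmorph_sign (@pC R n)) pcoef_pCM.
under eq_bigr do rewrite signE coefE.
case: eqVneq => [<- | ne_nu].
  rewrite (bigD1 1%g) //= odd_perm1 expr0 mul1r big1 ?addr0 => [|s ne_s].
    by rewrite (_ : _ == _) //; apply/eqP/mnmP => i; rewrite !mnmE invg1 perm1.
  case: eqP => [/mnmP eq_s|]; last by rewrite mulr0.
  case/eqP: ne_s; rewrite -[s]invgK; apply/eqP; rewrite eq_invg1; apply/eqP.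
  apply: (proj2 (@staircase_perm n nu nu _ le_nu le_nu _)) => i.
  by have := eq_s i; rewrite !mnmE.
rewrite big1 // => s _; case: eqP => [/mnmP eq_s|]; last by rewrite mulr0.
case/eqP: ne_nu; symmetry.
apply: (proj1 (@staircase_perm n nu' nu (s^-1)%g le_nu' le_nu _)) => i.
by have := eq_s i; rewrite !mnmE.
Qed.

End Alternants.

(** * The Cauchy-Binet formula indexed by partitions *)

Section CauchyBinet.
Implicit Types nu : intpart.

Lemma staircase_ord_inj n nu : injective (fun i : 'I_n => staircase n nu i).
Proof.
move=> i j e; apply: val_inj; case: (ltngtP i j) => // lt_ij.
  by have := @staircase_lt n nu _ _ lt_ij (ltn_ord _); rewrite e ltnn.
by have := @staircase_lt n nu _ _ lt_ij (ltn_ord _); rewrite e ltnn.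
Qed.

Lemma mkpart_subproof : sorted geq [::] && (0%N \notin [::]).
Proof. by []. Qed.

Definition mkpart (s : seq nat) : intpart :=
  insubd (IntPart mkpart_subproof) [seq x <- s | (0 < x)%N].

Lemma part_mkpart s i : sorted geq s -> part (mkpart s) i = nth 0%N s i.
Proof.
move=> s_sorted.
have -> : part (mkpart s) i = nth 0%N [seq x <- s | (0 < x)%N] i.
  rewrite /part /mkpart insubdK //; apply/andP.
  by split; [apply: (sorted_filter geq_trans) | rewrite mem_filter].
elim: s s_sorted i => //= x s IHs xs i; have s_sorted := path_sorted xs.
case: ltnP => [_ | x0]; first by case: i => //= i; apply: IHs.
rewrite IHs //; have /allP le_x := order_path_min geq_trans xs.
have nth0 j : nth 0%N s j = 0%N.
  case: (ltnP j (size s)) => [lt_j | ge_j]; last by rewrite nth_default.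
  by have := le_x _ (mem_nth 0%N lt_j); rewrite /geq /=; lia.
by case: i => [|i] /=; rewrite !nth0; lia.
Qed.

Definition in_box n N nu :=
  (size nu <= n)%N && all (fun i => (staircase n nu i < N)%N) (iota 0 n).

Definition box_parts n N : seq intpart :=
  [seq nu <- undup [seq mkpart [seq val x | x <- tval t] | t : n.-tuple 'I_N]
     | in_box n N nu].

Lemma box_parts_uniq n N : uniq (box_parts n N).
Proof. by rewrite filter_uniq ?undup_uniq. Qed.

Lemma mkpart_part n nu : (size nu <= n)%N ->
  mkpart [seq part nu i | i <- iota 0 n] = nu.
Proof.
move=> le_n; apply: part_inj => i; rewrite part_mkpart.
  case: (ltnP i n) => [lt_i | ge_i].
    by rewrite (nth_map 0%N) ?size_iota // nth_iota.
  by rewrite nth_default ?size_map ?size_iota // part_default // (leq_trans le_n).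
apply/(sortedP 0%N) => j; rewrite size_map size_iota => lt_j.
rewrite !(nth_map 0%N) ?size_iota ?(ltnW lt_j) // !nth_iota ?(ltnW lt_j) //.
exact: part_le.
Qed.

Lemma mem_box_parts n N nu : (nu \in box_parts n N) = in_box n N nu.
Proof.
rewrite mem_filter mem_undup; case: (boolP (in_box n N nu)) => //= nu_box.
have /andP[le_n /allP lt_N] := nu_box.
have lt_part (i : 'I_n) : (part nu i < N)%N.
  have := lt_N i; rewrite mem_iota ltn_ord => /(_ isT).
  by apply: leq_ltn_trans; apply: leq_addr.
apply/imageP; exists [tuple Ordinal (lt_part i) | i < n] => //.
rewrite -[LHS](mkpart_part le_n); congr mkpart.
by rewrite /= -map_comp -val_enum_ord -map_comp.
Qed.

(** Entry [i] is followed by [n - 1 - i] strictly smaller ones, so subtracting [n - 1 - i] leaves a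
    natural number, and strict decrease becomes weak decrease. *)
Lemma decreasing_staircase n (s : seq nat) : size s = n -> sorted gtn s ->
  exists2 nu : intpart, (size nu <= n)%N &
    forall i, (i < n)%N -> staircase n nu i = nth 0%N s i.
Proof.
move=> size_s s_sorted.
have gtn_trans : transitive gtn by move=> x y z /= xy yz; apply: ltn_trans yz xy.
have s_low i : (i < n)%N -> (n.-1 - i <= nth 0%N s i)%N.
  move=> lt_i; rewrite -[i](subKn (_ : i <= n.-1)%N); last by lia.
  have: (n.-1 - i < n)%N by lia.
  elim: (n.-1 - i)%N => [|k IHk] lt_k; first by lia.
  have lt_s : (nth 0 s (n.-1 - k) < nth 0 s (n.-1 - k.+1))%N.
    have lt_kn : (n.-1 - k.+1 < n.-1 - k)%N by lia.
    by apply: (sorted_ltn_nth gtn_trans 0%N s_sorted) => //; rewrite inE size_s; lia.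
  by have := IHk (ltnW lt_k); lia.
pose t := [seq (nth 0 s i - (n.-1 - i))%N | i <- iota 0 n].
have t_sorted : sorted geq t.
  apply/(sortedP 0%N) => j; rewrite size_map size_iota => lt_j.
  rewrite !(nth_map 0%N) ?size_iota ?(ltnW lt_j) // !nth_iota ?(ltnW lt_j) // !add0n.
  have := @sorted_ltn_nth _ gtn gtn_trans 0%N _ s_sorted j j.+1.
  by rewrite !inE size_s => /(_ (ltnW lt_j) lt_j (ltnSn j)) /=; lia.
exists (mkpart t) => [|i lt_i].
  by rewrite leqNgt -part_gt0 part_mkpart // nth_default // size_map size_iota.
rewrite /staircase part_mkpart // (nth_map 0%N) ?size_iota // nth_iota //=.
by rewrite subnK // s_low.
Qed.

Lemma injective_staircase n N (f : {ffun 'I_n -> 'I_N}) : injectiveb f ->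
  exists2 nu : intpart, in_box n N nu &
    exists s : 'S_n, forall i, f i = staircase n nu (s i) :> nat.
Proof.
move=> f_inj; pose c := [seq val (f i) | i <- enum 'I_n].
have c_uniq : uniq c.
  by rewrite map_inj_uniq ?enum_uniq // => i j /val_inj; apply/injectiveP.
have size_c : size c = n by rewrite size_map size_enum_ord.
pose t := sort geq c.
have t_c : perm_eq c t by rewrite perm_sym perm_sort.
have size_t : size t == n by rewrite size_sort size_c.
have t_sorted : sorted gtn t.
  rewrite gtn_sorted_uniq_geq -(perm_uniq t_c) c_uniq.
  by apply: sort_sorted => x y /=; apply: leq_total.
have [nu le_n nu_t] := decreasing_staircase (eqP size_t) t_sorted.
have /tuple_permP[s c_s] : perm_eq c (Tuple size_t) by [].
have f_s i : f i = staircase n nu (s i) :> nat.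
  have -> : f i = nth 0%N c i :> nat.
    by rewrite (nth_map i) ?size_enum_ord // nth_ord_enum.
  rewrite c_s nu_t // (nth_map i) ?size_enum_ord // nth_ord_enum.
  by rewrite (tnth_nth 0%N).
exists nu; last by exists s.
apply/andP; split=> //; apply/allP => i; rewrite mem_iota add0n => /andP[_ lt_i].
by have := f_s (s^-1 (Ordinal lt_i))%g; rewrite permKV /= => <-.
Qed.

Section Identity.
Variables (S : comNzRingType) (n N : nat).
Variables (A : 'I_n -> nat -> S) (B : nat -> 'I_n -> S).

(** Multilinearity in the rows chooses one index [f i] per row; if [f] is not injective, two rows of
    the remaining determinant coincide. *)
Lemma det_sum_prod :
  \det (\matrix_(i < n, j < n) \sum_(q < N) A i q * B q j)
  = \sum_(f : {ffun 'I_n -> 'I_N} | injectiveb f)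
       \prod_i A i (f i) * \det (\matrix_(i < n, j < n) B (f i) j).
Proof.
transitivity (\sum_(f : {ffun 'I_n -> 'I_N}) \sum_(s : 'S_n)
    (-1) ^+ s * \prod_i (A i (f i) * B (f i) (s i))).
  rewrite exchange_big; apply: eq_bigr => /= s _; rewrite -big_distrr /=.
  congr (_ * _); rewrite -(bigA_distr_bigA (fun i (q : 'I_N) => A i q * B q (s i))) /=.
  by apply: eq_bigr => x _; rewrite mxE.
have prodE (f : {ffun 'I_n -> 'I_N}) :
    \sum_(s : 'S_n) (-1) ^+ s * \prod_i (A i (f i) * B (f i) (s i))
    = \prod_i A i (f i) * \det (\matrix_(i < n, j < n) B (f i) j).
  rewrite big_distrr /=; apply: eq_bigr => s _.
  rewrite mulrCA big_split //=; congr (_ * (_ * _)).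
  by apply: eq_bigr => x _; rewrite mxE.
rewrite (bigID (fun f : {ffun 'I_n -> 'I_N} => injectiveb f)) /= addrC big1 ?add0r.
  by apply: eq_bigr => f _.
move=> f /injectivePn[i1 [i2 Di12 Ef12]].
rewrite prodE (determinant_alternate Di12) ?mulr0 // => j.
by rewrite !mxE Ef12.
Qed.

(** An injective choice of indices is a set of values, that is a partition of the box, together with
    an ordering of it. Summing over the orderings with their signs rebuilds the minor of [A]. *)
Lemma cauchy_binet :
  \det (\matrix_(i < n, j < n) \sum_(q < N) A i q * B q j)
  = \sum_(nu <- box_parts n N)
       \det (\matrix_(i < n, k < n) A i (staircase n nu k))
       * \det (\matrix_(k < n, j < n) B (staircase n nu k) j).
Proof.
rewrite det_sum_prod.
pose G (f : 'I_n -> nat) := \prod_i A i (f i) * \det (\matrix_(i < n, j < n) B (f i) j).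
transitivity (\sum_(nu <- box_parts n N) \sum_(s : 'S_n)
   G (fun i => staircase n nu (s i))); last first.
  apply: eq_bigr => nu _; set D := \matrix_(k < n, j < n) B _ _; set b := \det D.
  rewrite /determinant mulr_suml; apply: eq_bigr => s _.
  have -> : G (fun i => staircase n nu (s i))
          = \prod_i A i (staircase n nu (s i)) * ((-1) ^+ s * b).
    rewrite /G -det_perm -det_mulmx -row_permE; congr (_ * \det _).
    by apply/matrixP => i j; rewrite !mxE.
  by rewrite mulrCA mulrA; congr (_ * _ * _); apply: eq_bigr => i _; rewrite mxE.
pose word (g : 'I_n -> nat) := [seq g i | i <- enum 'I_n].
have wordE g (i : 'I_n) : nth 0%N (word g) i = g i.
  by rewrite (nth_map i) ?size_enum_ord // nth_ord_enum.
have word_inj g g' : word g = word g' -> g =1 g'.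
  by move=> eq_g i; rewrite -wordE eq_g wordE.
pose H c := G (fun i => nth 0%N c i).
have HE g : G g = H (word g).
  by congr G; apply: funext => i; rewrite wordE.
under [RHS]eq_bigr do under eq_bigr do rewrite HE.
transitivity (\sum_(f : {ffun 'I_n -> 'I_N} | injectiveb f) H (word (fun i => f i))).
  by apply: eq_bigr => f _; rewrite -HE.
pose inj := [pred f : {ffun 'I_n -> 'I_N} | injectiveb f].
transitivity (\sum_(c <- [seq word (fun i => f i) | f : {ffun 'I_n -> 'I_N} <- enum inj]) H c).
  by rewrite big_map big_enum.
transitivity (\sum_(c <- [seq word (fun i => staircase n nu (s i))
                         | nu : intpart <- box_parts n N, s : 'S_n <- enum 'S_n]) H c);
  last by rewrite big_allpairs_dep; apply: eq_bigr => nu _; rewrite big_enum.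
apply: perm_big; apply: uniq_perm.
- rewrite map_inj_uniq ?enum_uniq // => f g /word_inj eq_fg.
  by apply/ffunP => i; apply: val_inj; apply: eq_fg.
- apply: allpairs_uniq; rewrite ?box_parts_uniq ?enum_uniq //.
  move=> [nu s] [nu' s'] /allpairsP[[a b] /= [a_box _ [-> ->]]].
  move=> /allpairsP[[a' b'] /= [a'_box _ [-> ->]]] /word_inj eq_w.
  move: a_box a'_box; rewrite !mem_box_parts => /andP[le_a _] /andP[le_a' _].
  have [|-> s1] := @staircase_perm n a a' (b^-1 * b')%g le_a le_a'.
    by move=> i; rewrite permM -eq_w permKV.
  by rewrite -[b']mul1g -(mulgV b) -mulgA s1 mulg1.
move=> c; apply/mapP/allpairsP => [[f] | [[nu s] /= [nu_box _ ->]]].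
  rewrite mem_enum => /injective_staircase[nu nu_box [s f_s]] ->.
  exists (nu, s); rewrite mem_box_parts nu_box mem_enum; split=> //=.
  exact: eq_map.
move: nu_box; rewrite mem_box_parts => /andP[_ /allP lt_N].
have lt_s (i : 'I_n) : (staircase n nu (s i) < N)%N.
  by apply: lt_N; rewrite mem_iota ltn_ord.
exists [ffun i => Ordinal (lt_s i)]; last first.
  by apply: eq_map => i; rewrite ffunE.
rewrite mem_enum; apply/injectiveP => i j.
rewrite !ffunE => /(congr1 val)/staircase_ord_inj; exact: perm_inj.
Qed.
End Identity.
End CauchyBinet.

(** * Setting variables to zero *)

Section Restriction.
Variable R : comNzRingType.

(** The degree bounds in the index type of the product are dropped, so that splittings in different
    numbers of variables can be matched. *)
Definition mnm_splits n (m : 'X_{1..n}) : seq ('X_{1..n} * 'X_{1..n}) :=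
  [seq (bmnm k.1, bmnm k.2)
     | k : 'X_{1..n < (mdeg m).+1, (mdeg m).+1}
         <- enum [pred k : 'X_{1..n < (mdeg m).+1, (mdeg m).+1}
                    | m == (k.1 + k.2)%MM]].

Lemma mnm_splits_uniq n (m : 'X_{1..n}) : uniq (mnm_splits m).
Proof.
rewrite map_inj_uniq ?enum_uniq // => -[a b] [a' b'] /= [e1 e2].
by congr (_, _); apply: val_inj.
Qed.

Lemma mem_mnm_splits n (m a b : 'X_{1..n}) :
  ((a, b) \in mnm_splits m) = (a + b == m)%MM.
Proof.
apply/mapP/eqP => [[k] | def_m].
  by rewrite mem_enum => /eqP def_m [-> ->]; rewrite -def_m.
have lt_a : (mdeg a < (mdeg m).+1)%N by rewrite ltnS -def_m mdegD leq_addr.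
have lt_b : (mdeg b < (mdeg m).+1)%N by rewrite ltnS -def_m mdegD leq_addl.
by exists (BMultinom lt_a, BMultinom lt_b); rewrite ?mem_enum //= inE /= def_m.
Qed.

Lemma pcoefM_splits n (f g : mpser R n) m :
  pcoef (f * g) m = \sum_(k <- mnm_splits m) pcoef f k.1 * pcoef g k.2.
Proof. by rewrite big_map big_enum. Qed.

Lemma pcoefM_seq n (f g : mpser R n) m (r : seq ('X_{1..n} * 'X_{1..n})) :
    uniq r -> (forall a b, ((a, b) \in r) = (a + b == m)%MM) ->
  pcoef (f * g) m = \sum_(k <- r) pcoef f k.1 * pcoef g k.2.
Proof.
move=> r_uniq mem_r; rewrite pcoefM_splits; apply: perm_big.
apply: uniq_perm => //; first exact: mnm_splits_uniq.
by case=> a b; rewrite mem_mnm_splits mem_r.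
Qed.

Lemma extend_mnmE n (m : 'X_{1..n}) k : extend_mnm m k = nth 0%N m k.
Proof.
rewrite fsfunE in_fset mem_iota; case: ifP => //= /negbT.
by rewrite -leqNgt => ge_k; rewrite nth_default // size_tuple.
Qed.

Definition restrict_mnm n (M : {fsfun nat -> nat with 0%N}) : 'X_{1..n} :=
  [multinom M i | i < n].

Lemma nth_restrict_mnm n M k :
  nth 0%N (restrict_mnm n M) k = if (k < n)%N then M k else 0%N.
Proof.
case: ltnP => [lt_k | ge_k]; last by rewrite nth_default // size_tuple.
by rewrite -(mnm_nth 0%N _ (Ordinal lt_k)) mnmE.
Qed.

Lemma extend_mnmK n : cancel (@extend_mnm n) (restrict_mnm n).
Proof.
by move=> m; apply/mnmP => i; rewrite mnmE extend_mnmE -mnm_nth.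
Qed.

Definition embed_mnm n p (m : 'X_{1..n}) : 'X_{1..p} :=
  restrict_mnm p (extend_mnm m).

Lemma embed_mnmE n p (m : 'X_{1..n}) (i : 'I_p) : embed_mnm p m i = nth 0%N m i.
Proof. by rewrite mnmE extend_mnmE. Qed.

Lemma extend_embed n p (m : 'X_{1..n}) : (n <= p)%N ->
  extend_mnm (embed_mnm p m) = extend_mnm m.
Proof.
move=> le_np; apply/fsfunP => k; rewrite !extend_mnmE nth_restrict_mnm extend_mnmE.
by case: ltnP => // ge_k; rewrite nth_default // size_tuple (leq_trans le_np).
Qed.

Lemma embed_mnmK n p : (n <= p)%N -> cancel (@embed_mnm n p) (@embed_mnm p n).
Proof.
move=> le_np m.
by rewrite /embed_mnm -/(embed_mnm p m) extend_embed // extend_mnmK.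
Qed.

Lemma nth_mnmD n (m m' : 'X_{1..n}) k :
  nth 0%N (m + m')%MM k = (nth 0%N m k + nth 0%N m' k)%N.
Proof.
case: (ltnP k n) => [lt_k | ge_k]; last by rewrite !nth_default ?size_tuple.
by rewrite -!(mnm_nth 0%N _ (Ordinal lt_k)) mnmDE.
Qed.

Lemma embed_mnmD n p (m m' : 'X_{1..n}) :
  embed_mnm p (m + m')%MM = (embed_mnm p m + embed_mnm p m')%MM.
Proof. by apply/mnmP => i; rewrite mnmDE !embed_mnmE nth_mnmD. Qed.

Lemma mdeg_embed n p (m : 'X_{1..n}) : (n <= p)%N -> mdeg (embed_mnm p m) = mdeg m.
Proof.
move=> le_np; rewrite !mdegE; under eq_bigr do rewrite embed_mnmE.
under [RHS]eq_bigr do rewrite (mnm_nth 0%N).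
rewrite (big_ord_widen _ (fun i => nth 0%N m i) le_np) [RHS]big_mkcond.
apply: eq_bigr => i _; case: ltnP => // ge_i.
by rewrite nth_default // size_tuple.
Qed.

(** An exponent that is 0 in a sum is 0 in both summands, so a splitting of a padded monomial is
    itself padded. This makes [pres] multiplicative. *)
Lemma embed_mnm_split n p (m : 'X_{1..n}) (a b : 'X_{1..p}) : (n <= p)%N ->
  (a + b = embed_mnm p m)%MM ->
  [/\ embed_mnm p (embed_mnm n a) = a, embed_mnm p (embed_mnm n b) = b
    & (embed_mnm n a + embed_mnm n b = m)%MM].
Proof.
move=> le_np def_m.
have ab0 (i : 'I_p) : (n <= i)%N -> a i = 0%N /\ b i = 0%N.
  move=> ge_i; have := congr1 (fun k : 'X_{1..p} => k i) def_m.
  rewrite mnmDE embed_mnmE nth_default ?size_tuple // => /eqP.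
  by rewrite addn_eq0 => /andP[/eqP-> /eqP->].
have embK (c : 'X_{1..p}) : (forall i : 'I_p, (n <= i)%N -> c i = 0%N) ->
    embed_mnm p (embed_mnm n c) = c.
  move=> c0; apply/mnmP => i; rewrite embed_mnmE nth_restrict_mnm extend_mnmE.
  by case: ltnP => [_ | /c0->//]; rewrite -mnm_nth.
split; first by apply: embK => i /ab0[].
  by apply: embK => i /ab0[].
by rewrite -embed_mnmD def_m embed_mnmK.
Qed.

(* Setting the variables of index at least [n] to 0. *)
Definition pres n p (f : mpser R p) : mpser R n :=
  MPSer (fun m => pcoef f (embed_mnm p m)).

Lemma presM n p (f g : mpser R p) : (n <= p)%N ->
  pres n (f * g) = pres n f * pres n g.
Proof.
move=> le_np; apply: mpserP => m; rewrite pcoefM_splits.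
have -> : pcoef (pres n (f * g)) m = pcoef (f * g) (embed_mnm p m) by [].
rewrite (@pcoefM_seq _ _ _ _ [seq (embed_mnm p k.1, embed_mnm p k.2) | k <- mnm_splits m]).
- by rewrite big_map.
- rewrite map_inj_uniq ?mnm_splits_uniq // => -[a b] [a' b'] e.
  congr (_, _); apply: (can_inj (embed_mnmK le_np)); first exact: (congr1 fst e).
  exact: (congr1 snd e).
move=> a b; apply/mapP/eqP => [[[a' b'] + [-> ->]] | ].
  by rewrite mem_mnm_splits -embed_mnmD => /eqP ->.
case/embed_mnm_split=> // Ea Eb def_m; exists (embed_mnm n a, embed_mnm n b).
  by rewrite mem_mnm_splits def_m.
by rewrite /= Ea Eb.
Qed.

Lemma pres1 n p : (n <= p)%N -> pres n (1 : mpser R p) = 1.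
Proof.
move=> le_np; apply: mpserP => m /=; congr ((nat_of_bool _)%:R).
by rewrite -!mdeg_eq0 mdeg_embed.
Qed.

Lemma pres_det n p k (A : 'M[mpser R p]_k) : (n <= p)%N ->
  pres n (\det A) = \det (map_mx (@pres n p) A).
Proof.
move=> le_np; have presN (f : mpser R p) : pres n (- f) = - pres n f by apply: mpserP.
rewrite /determinant.
have -> : pres n (\sum_(s : 'S_k) (-1) ^+ s * \prod_i A i (s i))
        = \sum_(s : 'S_k) pres n ((-1) ^+ s * \prod_i A i (s i)).
  by apply: mpserP => m /=; rewrite !pcoef_sum.
apply: eq_bigr => s _; rewrite presM //; congr (_ * _).
  by case: (odd_perm s); rewrite ?expr1 ?expr0 ?presN pres1.
transitivity (\prod_i pres n (A i (s i))); last by apply: eq_bigr => i _; rewrite mxE.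
by apply: big_morph => [f g|]; rewrite (presM, pres1).
Qed.

Lemma pres_jacobi_trudi n p nu k : (n <= p)%N ->
  pres n (jacobi_trudi R p nu k) = jacobi_trudi R n nu k.
Proof.
move=> le_np; rewrite /jacobi_trudi pres_det //; congr (\det _).
apply/matrixP => i j; rewrite !mxE /hdiff; case: ifP => _; last exact: mpserP.
apply: mpserP => m /=; rewrite mdeg_embed //; congr ((nat_of_bool (_ && _))%:R).
by apply/forallP/forallP => _ x; apply: implybT.
Qed.

End Restriction.

(** * Stable series and Schur expansions *)

Section StableSeries.
Variable R : comNzRingType.
Implicit Types (F : series R) (M : {fsfun nat -> nat with 0%N}).

Lemma fsfun_bound M : exists b, forall n, (b <= n)%N ->
  extend_mnm (restrict_mnm n M) = M.
Proof.
exists (\max_(k <- finsupp M) k).+1 => n lt_n; apply/fsfunP => k.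
rewrite extend_mnmE nth_restrict_mnm; case: ltnP => // ge_k.
case: finsuppP => // k_M.
have := @leq_bigmax_seq _ (enum_fset (finsupp M)) predT id k k_M isT.
by move/leq_ltn_trans => /(_ _ lt_n); rewrite ltnNge ge_k.
Qed.

Lemma series_eq l F G :
  (forall n, (l <= n)%N -> specialize n F = specialize n G) -> F = G.
Proof.
move=> FG; apply: funext => M; have [b bM] := fsfun_bound M.
have := congr1 (fun f => pcoef f (restrict_mnm (maxn b l) M)) (FG _ (leq_maxr b l)).
by rewrite /= bM ?leq_maxl.
Qed.

Lemma stable_seriesE l (f : forall n, mpser R n) F :
  (forall n, (l <= n)%N -> specialize n F = f n) -> stable_series l f = F.
Proof.
move=> Ff; rewrite /stable_series; case: xgetP => [G _ /= Gf | /(_ F)//].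
by apply: (@series_eq l) => n le_n; rewrite Gf ?Ff.
Qed.

(** The coefficient at [M] is read in a number [b M] of variables large enough for [M];
    compatibility makes it independent of that number. *)
Lemma series_glue (f : forall n, mpser R n) :
    (forall n p, (n <= p)%N -> pres n (f p) = f n) ->
  exists F, forall n, specialize n F = f n.
Proof.
move=> res_f; have [b bM] := choice fsfun_bound.
exists (fun M => pcoef (f (b M)) (restrict_mnm (b M) M)) => n.
apply: mpserP => m /=; set M := extend_mnm m.
rewrite -(res_f _ (maxn n (b M))) ?leq_maxr // -[in RHS](res_f _ (maxn n (b M))) ?leq_maxl //=.
by rewrite /embed_mnm bM.
Qed.

(** The definition of [schur] constrains only [n >= size nu]; the Jacobi-Trudi determinant of fixed
    size is compatible with every restriction, so it also covers fewer variables. *)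
Lemma specialize_schur n nu :
  specialize n (schur R nu) = jacobi_trudi R n nu (size nu).
Proof.
have [F F_jt] := series_glue (fun n p => @pres_jacobi_trudi R n p nu (size nu)).
rewrite -F_jt; congr specialize; apply: stable_seriesE => {}n le_n.
by rewrite F_jt; symmetry; apply: pser_div_vandermonde; rewrite -alternantE.
Qed.

Definition schur_sum (a : intpart -> R) : series R :=
  fun M => \sum_(nu \in [set: intpart]) a nu * schur R nu M.

(** Partitions longer than [n] vanish in [n] variables, and a staircase value of at least [N + n]
    forces a first part of at least [N], hence only terms of degree at least [N]. So the sum at a
    monomial has finite support and is not the default value. *)
Lemma schur_sum_box n N (a : intpart -> R) :
  eqd N (specialize n (schur_sum a))
    (\sum_(nu <- box_parts n (N + n)) pC (a nu) * jacobi_trudi R n nu (size nu)).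
Proof.
move=> m lt_m; rewrite pcoef_sum [LHS]/= /schur_sum.
rewrite (fsbigE (box_parts n (N + n))) ?box_parts_uniq //; last first.
  move=> nu _; rewrite mem_box_parts.
  have -> : schur R nu (extend_mnm m) = pcoef (jacobi_trudi R n nu (size nu)) m.
    by rewrite -specialize_schur.
  case: (leqP (size nu) n) => [le_n | lt_n]; last by rewrite jacobi_trudi_eq0 ?mulr0.
  rewrite /in_box le_n -has_predC => /hasP[i]; rewrite mem_iota /= => lt_i ge_N.
  rewrite jacobi_trudi_low ?mulr0 //; have := part_le nu (leq0n i).
  by move: ge_N; rewrite /staircase; lia.
rewrite big_mkcond; apply: eq_bigr => nu _; rewrite classical_sets.in_setT pcoef_pCM.
by rewrite -specialize_schur.
Qed.

Lemma schur_sum_alternant n N (a : intpart -> R) :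
  eqd N (specialize n (schur_sum a) * vandermonde R n)
    (\sum_(nu <- box_parts n (N + n)) pC (a nu) * alternant R n nu).
Proof.
have -> : \sum_(nu <- box_parts n (N + n)) pC (a nu) * alternant R n nu
   = (\sum_(nu <- box_parts n (N + n)) pC (a nu) * jacobi_trudi R n nu (size nu))
     * vandermonde R n.
  rewrite mulr_suml big_seq [RHS]big_seq; apply: eq_bigr => nu.
  by rewrite mem_box_parts => /andP[le_n _]; rewrite -mulrA -alternantE.
by apply: eqdM => //; apply: schur_sum_box.
Qed.

(** After multiplication by the Vandermonde product in [size ka] variables, [a ka] is the
    coefficient at the staircase exponents of [ka]. Hence Schur coefficients are unique and [xget]
    can return no others. *)
Lemma schur_sum_inj : injective schur_sum.
Proof.
move=> a a' eq_a; apply: funext => ka; pose n := size ka.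
pose m : 'X_{1..n} := [multinom staircase n ka j | j < n].
have coef (c : intpart -> R) :
    pcoef (specialize n (schur_sum c) * vandermonde R n) m = c ka.
  rewrite (@schur_sum_alternant _ (mdeg m).+1) // pcoef_sum.
  have ka_box : ka \in box_parts n ((mdeg m).+1 + n).
    rewrite mem_box_parts /in_box leqnn /=; apply/allP => i.
    rewrite mem_iota add0n => /andP[_ lt_i].
    have -> : staircase n ka i = m (Ordinal lt_i) by rewrite mnmE.
    by rewrite mdegE (bigD1 (Ordinal lt_i)) //=; lia.
  rewrite (bigD1_seq ka) ?box_parts_uniq // pcoef_pCM pcoef_alternant //.
  rewrite eqxx mulr1 big_seq_cond big1 => [|nu /andP[+ ne_nu]]; first exact: addr0.
  rewrite mem_box_parts => /andP[le_nu _].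
  by rewrite pcoef_pCM pcoef_alternant // (negPf ne_nu) mulr0.
by rewrite -(coef a) eq_a coef.
Qed.

Lemma schur_coef_sum a : schur_coef (schur_sum a) = a.
Proof.
rewrite /schur_coef; case: xgetP => [a' _ /= exp_a' | /(_ a)[]//].
by apply: schur_sum_inj; apply: funext => M; rewrite exp_a'.
Qed.

(** Cauchy-Binet with the powers of the variables as second factor: the minors of that factor are
    alternants, and those of [A] are the Schur coefficients. *)
Lemma det_schur_sum n (M : 'M[mpser R n]_n) (A : 'I_n -> nat -> R) a :
    (forall N i j, eqd N (M i j) (\sum_(q < N) pC (A i q) * pX j ^+ q)) ->
    (forall nu : intpart, (size nu <= n)%N ->
       a nu = \det (\matrix_(i < n, k < n) A i (staircase n nu k))) ->
  pser_div (\det M) (vandermonde R n) = specialize n (schur_sum a).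
Proof.
(* Cauchy-Binet needs a finite sum, so the identity is checked modulo each degree [N], with rows cut
   at [N + n] to match the box. *)
move=> M_A a_A; apply: pser_div_vandermonde; apply: eqd_eq => N.
apply: eqd_trans (@schur_sum_alternant _ N _) _.
have -> : \sum_(nu <- box_parts n (N + n)) pC (a nu) * alternant R n nu
    = \det (\matrix_(i < n, j < n) \sum_(q < N + n) pC (A i q) * pX j ^+ q : 'M[mpser R n]_n).
  rewrite (cauchy_binet _ (fun i q => pC (A i q)) (fun q j => pX j ^+ q)).
  rewrite big_seq [RHS]big_seq; apply: eq_bigr => nu.
  rewrite mem_box_parts => /andP[le_nu _]; rewrite a_A // -det_map_mx.
  by congr (\det _ * _); apply/matrixP => i k; rewrite !mxE.
apply: eqd_det => i j m lt_m; rewrite mxE; symmetry; apply: (M_A (N + n)%N).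
by apply: leq_trans lt_m _; apply: leq_addr.
Qed.

End StableSeries.

(** * Univariate series and products of linear factors *)

Section Univariate.
Variable K : comNzRingType.
Implicit Types (f g : mpser K 1) (c : K).

Definition ucoef f k : K := pcoef f [multinom k | _ < 1].

Lemma mnm1D a b :
  ([multinom a | _ < 1] + [multinom b | _ < 1])%MM = [multinom (a + b)%N | _ < 1].
Proof. by apply/mnmP => i; rewrite mnmDE !mnmE. Qed.

Lemma mnm1K (m : 'X_{1..1}) : [multinom m ord0 | _ < 1] = m.
Proof. by apply/mnmP => i; rewrite mnmE [i]ord1. Qed.

Lemma ucoef_eq f g : (forall k, ucoef f k = ucoef g k) -> f = g.
Proof. by move=> fg; apply: mpserP => m; rewrite -(mnm1K m); apply: fg. Qed.

Lemma ucoefM f g k : ucoef (f * g) k = \sum_(i < k.+1) ucoef f i * ucoef g (k - i).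
Proof.
rewrite /ucoef (@pcoefM_seq _ _ _ _ _
  [seq ([multinom i | _ < 1], [multinom (k - i)%N | _ < 1]) | i <- iota 0 k.+1]).
- by rewrite big_map -(big_mkord predT (fun i => ucoef f i * ucoef g (k - i))).
- rewrite map_inj_uniq ?iota_uniq // => i j e.
  by have := congr1 (fun p : 'X_{1..1} * 'X_{1..1} => p.1 ord0) e; rewrite /= !mnmE.
move=> a b; apply/mapP/eqP => [[i] | /(congr1 (fun m : 'X_{1..1} => m ord0))].
  rewrite mem_iota add0n ltnS /= => le_i [-> ->].
  by rewrite mnm1D subnKC.
rewrite mnmDE mnmE => def_k; exists (a ord0).
  by rewrite mem_iota /= add0n ltnS -def_k leq_addr.
by congr (_, _); rewrite -?def_k ?addKn mnm1K.
Qed.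

Lemma ucoef0M f g : ucoef (f * g) 0 = ucoef f 0 * ucoef g 0.
Proof. by rewrite ucoefM big_ord1. Qed.

Lemma ucoef1 k : ucoef 1 k = (k == 0%N)%:R.
Proof.
rewrite /ucoef /=; congr ((nat_of_bool _)%:R); rewrite -mdeg_eq0 mdegE big_ord1.
by rewrite mnmE.
Qed.

Lemma ucoef_XM f k :
  ucoef (pX ord0 * f) k = if k is k'.+1 then ucoef f k' else 0.
Proof.
rewrite /ucoef pcoef_pXM lep1mP mnmE; case: k => [|k] //=.
congr pcoef; apply/mnmP => i.
by rewrite mnmBE !mnmE [i]ord1 eqxx subn1.
Qed.

Lemma ucoef_XnM f a k :
  ucoef (pX ord0 ^+ a * f) k = if (a <= k)%N then ucoef f (k - a) else 0.
Proof.
elim: a k => [|a IHa] k; first by rewrite expr0 mul1r subn0.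
by rewrite exprS -mulrA ucoef_XM; case: k.
Qed.

Definition lin c : mpser K 1 := 1 - pC c * pX ord0.

Lemma lin_unit c : lin c \is a GRing.unit.
Proof. exact: unit_one_subX. Qed.

Lemma ucoef_lin c f k :
  ucoef (lin c * f) k = ucoef f k - c * (if k is k'.+1 then ucoef f k' else 0).
Proof. by rewrite -ucoef_XM mulrBl mul1r -mulrA /ucoef pcoefB pcoef_pCM. Qed.

Lemma ucoef_lin_inv c k : ucoef (lin c)^-1 k = c ^+ k.
Proof.
pose g : mpser K 1 := MPSer (fun m => c ^+ m ord0).
have gE k' : ucoef g k' = c ^+ k' by rewrite /ucoef /= mnmE.
suff lin_g : lin c * g = 1 by rewrite -gE -(mulKr (lin_unit c) g) lin_g mulr1.
apply: ucoef_eq => -[|k']; rewrite ucoef_lin !gE ucoef1 ?mulr0 ?subr0 //=.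
by rewrite exprS subrr.
Qed.

Definition linp (s : seq K) : mpser K 1 := \prod_(c <- s) lin c.

Lemma linp_unit s : linp s \is a GRing.unit.
Proof. by apply: rpred_prod => c _; apply: lin_unit. Qed.

Lemma linp_cons c s : linp (c :: s) = lin c * linp s.
Proof. exact: big_cons. Qed.

Lemma linp_cat s t : linp (s ++ t) = linp s * linp t.
Proof. exact: big_cat. Qed.

Lemma ucoef_linp_high s k : (size s < k)%N -> ucoef (linp s) k = 0.
Proof.
elim: s k => [|c s IHs] [|k] //= lt_k; first by rewrite /linp big_nil ucoef1.
by rewrite linp_cons ucoef_lin !IHs ?mulr0 ?subr0 // ltnW.
Qed.

Lemma ucoef0_linp s : ucoef (linp s) 0 = 1.
Proof.
elim: s => [|c s IHs]; first by rewrite /linp big_nil ucoef1.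
by rewrite linp_cons ucoef_lin mulr0 subr0.
Qed.

Lemma ucoef0_linp_div s t : ucoef (linp s / linp t) 0 = 1.
Proof.
have := ucoef0M (linp s / linp t) (linp t).
by rewrite divrK ?linp_unit // !ucoef0_linp mulr1.
Qed.

(** An entry of the Toeplitz matrix of [f], with 0 for negative exponents as in [hdiff]. *)
Definition ucoef_diff f p q : K := if (q <= p)%N then ucoef f (p - q) else 0.

Lemma ucoef_diff_eq f p q p' q' :
  (p + q' = p' + q)%N -> ucoef_diff f p q = ucoef_diff f p' q'.
Proof.
move=> e; rewrite /ucoef_diff; have -> : (q' <= p')%N = (q <= p)%N by lia.
by case: ifP => // le_qp; congr ucoef; lia.
Qed.

(** Toeplitz matrices multiply as their series do. Only [a <= q <= b] contributes, so cutting at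
    [N > b] loses nothing. *)
Lemma ucoef_diffM f g N a b : (b < N)%N ->
  \sum_(q < N) ucoef_diff f q a * ucoef_diff g b q = ucoef_diff (f * g) b a.
Proof.
move=> lt_b; rewrite -(big_mkord predT (fun q => ucoef_diff f q a * ucoef_diff g b q)).
have low q : (q < a)%N -> ucoef_diff f q a = 0.
  by move=> lt_q; rewrite /ucoef_diff leqNgt lt_q.
have high q : (b < q)%N -> ucoef_diff g b q = 0.
  by move=> lt_q; rewrite /ucoef_diff leqNgt lt_q.
rewrite [RHS]/ucoef_diff; case: leqP => [le_ab | lt_ba]; last first.
  rewrite big_nat big1 // => q _; case: (leqP q b) => [le_q | /high->].
    by rewrite low ?mul0r // (leq_ltn_trans le_q).
  exact: mulr0.
rewrite (big_cat_nat (n := a)) //; last exact: leq_trans le_ab (ltnW lt_b).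
rewrite [LHS]/= big_nat big1 ?add0r => [|q /andP[_ lt_q]]; last by rewrite low ?mul0r.
rewrite (big_cat_nat (n := b.+1)) //; last exact: leq_trans le_ab (leqnSn b).
rewrite [LHS]/= addrC big_nat big1 ?add0r => [|q /andP[lt_q _]]; last by rewrite high ?mulr0.
rewrite -{1}[a]add0n big_addn big_mkord subSn // ucoefM.
apply: eq_bigr => i _; have := ltn_ord i; rewrite ltnS => le_i.
rewrite /ucoef_diff leq_addl addnK; have -> : (i + a <= b)%N by lia.
by congr (_ * ucoef _ _); lia.
Qed.

End Univariate.

Arguments ucoef : simpl never.

(** * Substituting a variable, and the rows of the two determinants *)

Section Substitution.
Variables (R : comNzRingType) (n : nat).
Implicit Types (f : mpser R 1) (j : 'I_n).

Definition subst j f : mpser R n :=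
  MPSer (fun m => if m == (U_(j) *+ m j)%MM then ucoef f (m j) else 0).

Lemma subst1 j : subst j 1 = 1.
Proof.
apply: mpserP => m /=; rewrite ucoef1; case: eqP => [-> | ne_m].
  by rewrite -mdeg_eq0 mdegMn mdeg1 mul1n mulmnE mnm1E eqxx mul1n.
by case: eqP => // m0; case: ne_m; rewrite m0 mnm0E mulm0n.
Qed.

Lemma substX j f : subst j (pX ord0 * f) = pX j * subst j f.
Proof.
apply: mpserP => m; rewrite pcoef_pXM /= ucoef_XM.
case: (boolP (U_(j) <= m)%MM) => [le_jm | nle_jm]; last first.
  have -> : m j = 0%N by apply/eqP; rewrite -[_ == _]negbK -lep1mP.
  by case: eqP.
move: (submK le_jm); set k := (m - U_(j))%MM => <-.
by rewrite mnmDE mnm1E eqxx addn1 mulmS [(k + _)%MM]addmC eqm_add2l.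
Qed.

Lemma substXn j a f : subst j (pX ord0 ^+ a * f) = pX j ^+ a * subst j f.
Proof.
by elim: a => [|a IHa]; rewrite ?expr0 ?mul1r // !exprS -!mulrA substX IHa.
Qed.

Lemma subst_lin j c f : subst j (lin c * f) = (1 - pC c * pX j) * subst j f.
Proof.
rewrite [RHS]mulrBl mul1r -mulrA -substX; apply: mpserP => m.
rewrite pcoefB pcoef_pCM /= ucoef_lin ucoef_XM.
by case: ifP => // _; rewrite mulr0 subr0.
Qed.

Lemma subst_linp j s f :
  subst j (linp s * f) = \prod_(c <- s) (1 - pC c * pX j) * subst j f.
Proof.
elim: s => [|c s IHs]; first by rewrite /linp !big_nil !mul1r.
by rewrite linp_cons big_cons -!mulrA subst_lin IHs.
Qed.

Lemma subst_linp_div j s t :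
  subst j (linp s / linp t)
  = \prod_(c <- s) (1 - pC c * pX j) / \prod_(c <- t) (1 - pC c * pX j).
Proof.
have t_unit : \prod_(c <- t) (1 - pC c * pX j : mpser R n) \is a GRing.unit.
  by apply: rpred_prod => c _; apply: unit_one_subX.
apply: (mulIr t_unit); rewrite divrK // mulrC -subst_linp.
rewrite mulrC divrK ?linp_unit // -[linp s]mulr1.
by rewrite subst_linp subst1 mulr1.
Qed.

Lemma pcoef_sumX j N (c : nat -> R) m :
  pcoef (\sum_(q < N) pC (c q) * pX j ^+ q) m
  = if (m == (U_(j) *+ m j)%MM) && (m j < N)%N then c (m j) else 0.
Proof.
rewrite pcoef_sum; under eq_bigr do rewrite pcoef_pCM pcoef_expX.
case: andP => [[/eqP def_m lt_m] | ne_m].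
  rewrite (bigD1 (Ordinal lt_m)) //= -def_m eqxx mulr1 big1 ?addr0 // => q ne_q.
  case: eqP => [mq | _]; last by rewrite mulr0.
  case/eqP: ne_q; apply: val_inj => /=.
  by rewrite mq mulmnE mnm1E eqxx mul1n.
rewrite big1 // => q _; case: eqP => [mq | _]; last by rewrite mulr0.
case: ne_m; have mjq : m j = q by rewrite mq mulmnE mnm1E eqxx mul1n.
by rewrite mjq -mq eqxx ltn_ord.
Qed.

Lemma mnm_le_mdeg (m : 'X_{1..n}) j : (m j <= mdeg m)%N.
Proof. by rewrite mdegE (bigD1 j) //= leq_addr. Qed.

Lemma eqd_expX_subst N j a f :
  eqd N (pX j ^+ a * subst j f) (\sum_(q < N) pC (ucoef_diff f q a) * pX j ^+ q).
Proof.
move=> m lt_m; rewrite -substXn (pcoef_sumX j N (fun q => ucoef_diff f q a)) /= ucoef_XnM.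
by rewrite (leq_ltn_trans (mnm_le_mdeg m j) lt_m) andbT.
Qed.

(** [hsym] works over the coefficient ring [mpser R n], where parameters are constants [pC]; the
    lift brings series over [R] there. *)
Definition scalar_lift (f : mpser R 1) : mpser (mpser R n) 1 :=
  MPSer (fun m => pC (pcoef f m)).

Lemma ucoef_scalar_lift f k : ucoef (scalar_lift f) k = pC (ucoef f k).
Proof. by []. Qed.

Lemma scalar_lift1 : scalar_lift 1 = 1.
Proof. by apply: ucoef_eq => k; rewrite ucoef_scalar_lift !ucoef1 rmorph_nat. Qed.

Lemma scalar_lift_linp s f :
  scalar_lift (linp s * f) = linp [seq pC c | c <- s] * scalar_lift f.
Proof.
elim: s => [|c s IHs]; first by rewrite /linp !big_nil !mul1r.
rewrite /= !linp_cons -!mulrA -IHs; apply: ucoef_eq => k.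
rewrite ucoef_lin !ucoef_scalar_lift ucoef_lin rmorphB rmorphM /=.
by case: k => [|k] //=; rewrite rmorph0.
Qed.

Lemma scalar_lift_linp_div s t :
  scalar_lift (linp s / linp t)
  = linp [seq pC c | c <- s] / linp [seq pC c | c <- t].
Proof.
apply: (mulIr (linp_unit [seq pC c | c <- t])).
rewrite divrK ?linp_unit // mulrC -scalar_lift_linp.
rewrite mulrC divrK ?linp_unit // -[linp s]mulr1.
by rewrite scalar_lift_linp scalar_lift1 mulr1.
Qed.

(** The generating function of the alphabet is [f(t) / (1 - x_j t)] with [f] over [R], so the
    geometric series gives [h_p] as the sum of the [f_(p-q) x_j^q]. Here [q] enters with the sign
    opposite to that in [eqd_expX_subst], which lets the two expansions be composed. *)
Lemma eqd_hsym (alpha beta : nat -> R) N j a b p :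
  eqd N (hsym p (galphabet alpha beta j a b))
    (\sum_(q < N) pC (ucoef_diff (linp [seq alpha k | k <- iota 1 a]
                                / linp [seq beta k | k <- iota 1 b]) p q) * pX j ^+ q).
Proof.
set f := linp _ / linp _.
have -> : hsym p (galphabet alpha beta j a b)
    = \sum_(q < p.+1) pC (ucoef_diff f p q) * pX j ^+ q.
  have -> : hsym p (galphabet alpha beta j a b)
      = ucoef ((lin (pX j))^-1 * scalar_lift f) p.
    rewrite /hsym -/(ucoef _ p); congr ucoef.
    rewrite /hgen /galphabet big_cons big_cat !big_map /=; congr (_ * _).
    rewrite scalar_lift_linp_div /linp !big_map; congr (_ * _).
    rewrite -[RHS]prodrV => [|k _]; first by apply: eq_bigr => k _; rewrite exprN1.
    exact: lin_unit.
  rewrite ucoefM; apply: eq_bigr => q _; rewrite ucoef_lin_inv mulrC.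
  by rewrite /ucoef_diff -ltnS ltn_ord.
move=> m lt_m; rewrite (pcoef_sumX j p.+1 (ucoef_diff f p)) (pcoef_sumX j N (ucoef_diff f p)).
rewrite (leq_ltn_trans (mnm_le_mdeg m j) lt_m) andbT ltnS /ucoef_diff.
by case: (m == _); case: (m j <= p)%N.
Qed.

End Substitution.

(** * Schur expansions of G and g, and their pairing *)

Section Duality.
Variables (R : comNzRingType) (alpha beta : nat -> R).
Implicit Types lam mu nu : intpart.

Definition Grow lam i : mpser R 1 :=
  linp [seq beta k | k <- iota 1 i] / linp [seq alpha k | k <- iota 1 (part lam i)].

Definition grow mu i : mpser R 1 :=
  linp [seq alpha k | k <- iota 1 (part mu i).-1] / linp [seq beta k | k <- iota 1 i].

(** The exponent is the difference of the staircase values at [k] and [i], in which [n] cancels; so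
    the coefficient depends only on the two partitions. *)
Definition Gcoef lam nu : R :=
  let p := maxn (size lam) (size nu) in
  \det (\matrix_(i < p, k < p)
    ucoef_diff (Grow lam i) (part nu k + i) (part lam i + k)).

Definition gcoef mu nu : R :=
  let p := maxn (size mu) (size nu) in
  \det (\matrix_(i < p, k < p)
    ucoef_diff (grow mu i) (part mu i + k) (part nu k + i)).

(** The unitriangular part consists of the columns beyond both lengths, so [det_stable] is applied
    to the transpose. *)
Lemma GcoefE n lam nu : (size lam <= n)%N -> (size nu <= n)%N ->
  Gcoef lam nu = \det (\matrix_(i < n, k < n)
    ucoef_diff (Grow lam i) (staircase n nu k) (staircase n lam i)).
Proof.
move=> le_lam le_nu; symmetry.
pose M k i := ucoef_diff (Grow lam i) (part nu k + i) (part lam i + k).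
transitivity (\det (\matrix_(k < n, i < n) M k i)).
  rewrite -det_tr; congr (\det _); apply/matrixP => k i; rewrite !mxE.
  apply: ucoef_diff_eq; rewrite /staircase.
  by have := ltn_ord i; have := ltn_ord k; lia.
rewrite (@det_stable _ M (maxn (size lam) (size nu)) n) ?geq_max ?le_lam //.
  by rewrite -det_tr; congr (\det _); apply/matrixP => i k; rewrite !mxE.
move=> k i; rewrite geq_max => /andP[lam_k nu_k] le_ik.
rewrite /M part_default // add0n /ucoef_diff.
case: (ltngtP k i) le_ik => // [lt_ik | <-] _.
  by rewrite leqNgt (leq_trans lt_ik) // leq_addl.
by rewrite part_default // add0n leqnn subnn ucoef0_linp_div.
Qed.

Lemma gcoefE n mu nu : (size mu <= n)%N -> (size nu <= n)%N ->
  gcoef mu nu = \det (\matrix_(i < n, k < n)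
    ucoef_diff (grow mu i) (staircase n mu i) (staircase n nu k)).
Proof.
move=> le_mu le_nu; symmetry.
pose M i k := ucoef_diff (grow mu i) (part mu i + k) (part nu k + i).
transitivity (\det (\matrix_(i < n, k < n) M i k)).
  congr (\det _); apply/matrixP => k i; rewrite !mxE.
  apply: ucoef_diff_eq; rewrite /staircase.
  by have := ltn_ord i; have := ltn_ord k; lia.
rewrite (@det_stable _ M (maxn (size mu) (size nu)) n) ?geq_max ?le_mu //.
move=> k i; rewrite geq_max => /andP[mu_k nu_k] le_ik.
rewrite /M part_default // add0n /ucoef_diff.
case: (ltngtP k i) le_ik => // [lt_ik | <-] _.
  by rewrite leqNgt (leq_trans lt_ik) // leq_addl.
by rewrite part_default // add0n leqnn subnn ucoef0_linp_div.
Qed.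

(** If [nu_i > mu_i], every entry with row at least [i] and column at most [i] has a negative
    exponent. So [g] is a finite combination of Schur functions and the Hall sum is finite. *)
Lemma gcoef_contained mu nu : gcoef mu nu != 0 ->
  forall i, (part nu i <= part mu i)%N.
Proof.
move=> nz i; rewrite leqNgt; apply: contra nz => lt_i; apply/eqP.
have lt_in : (i < maxn (size mu) (size nu))%N.
  rewrite leq_max orbC -part_gt0; move: lt_i; case: (part nu i) => //.
apply: (@det_zero_block _ _ _ (Ordinal lt_in)) => k j /= le_ik le_ji.
rewrite mxE /ucoef_diff leqNgt.
have := part_le mu le_ik; have := part_le nu le_ji.
by case: ltnP => //; lia.
Qed.

Lemma GseriesE lam : Gseries alpha beta lam = schur_sum (Gcoef lam).
Proof.
apply: stable_seriesE => n le_n; symmetry.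
apply: (det_schur_sum (A := fun i q => ucoef_diff (Grow lam i) q (staircase n lam i))).
  move=> N i j; rewrite mxE -mulrA.
  rewrite (_ : _ / _ = subst j (Grow lam i)); first exact: eqd_expX_subst.
  by rewrite subst_linp_div !big_map /index_iota !subn1.
by move=> nu le_nu; rewrite -GcoefE.
Qed.

Lemma gseriesE mu : gseries alpha beta mu = schur_sum (gcoef mu).
Proof.
apply: stable_seriesE => n le_n; symmetry.
apply: (det_schur_sum (A := fun i q => ucoef_diff (grow mu i) (staircase n mu i) q)).
  by move=> N i j; rewrite mxE; apply: eqd_hsym.
by move=> nu le_nu; rewrite -gcoefE.
Qed.

(** Both expansions have minors over the same staircase sets as coefficients, so Cauchy-Binet read
    backwards gives the determinant of a product, whose entries come from [ucoef_diffM]. *)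
Lemma hall_det lam mu n : (size lam <= n)%N -> (size mu <= n)%N ->
  hall (Gseries alpha beta lam) (gseries alpha beta mu)
  = \det (\matrix_(i < n, j < n)
      ucoef_diff (Grow lam i * grow mu j) (staircase n mu j) (staircase n lam i)).
Proof.
move=> le_lam le_mu; rewrite /hall GseriesE gseriesE !schur_coef_sum.
(* [N] exceeds all staircase values of [mu]: the truncated products are exact and the box holds
   every [nu] contained in [mu]. *)
pose N := (part mu 0 + n).+1.
have mu_N (i : 'I_n) : (staircase n mu i < N)%N.
  by have := part_le mu (leq0n i); rewrite /staircase /N; have := ltn_ord i; lia.
transitivity (\det (\matrix_(i < n, j < n) \sum_(q < N)
    ucoef_diff (Grow lam i) q (staircase n lam i)
    * ucoef_diff (grow mu j) (staircase n mu j) q)); last first.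
  by congr (\det _); apply/matrixP => i j; rewrite !mxE ucoef_diffM.
rewrite (cauchy_binet _ (fun i q => ucoef_diff (Grow lam i) q (staircase n lam i))
  (fun q j => ucoef_diff (grow mu j) (staircase n mu j) q)).
rewrite (fsbigE (box_parts n N)) ?box_parts_uniq //; last first.
  move=> nu _; rewrite mem_box_parts; apply: contraNeq => nz.
  have {}nz : gcoef mu nu != 0 by apply: contraNneq nz => ->; rewrite mulr0.
  have le_part := gcoef_contained nz; apply/andP; split.
    rewrite leqNgt -part_gt0 -leqNgt; apply: leq_trans (le_part n) _.
    by rewrite part_default.
  apply/allP => i; rewrite mem_iota add0n => /andP[_ lt_i].
  have := mu_N (Ordinal lt_i); rewrite /staircase /=; have := le_part i; lia.
rewrite big_mkcond big_seq [RHS]big_seq; apply: eq_bigr => nu.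
rewrite mem_box_parts classical_sets.in_setT => /andP[le_nu _].
rewrite (GcoefE le_lam le_nu) (gcoefE le_mu le_nu) -[X in _ * X]det_tr.
by congr (_ * \det _); apply/matrixP => i j; rewrite !mxE.
Qed.

(* For [j <= i] and [lam_i < mu_j] the quotient [Grow lam i * grow mu j] is a
   polynomial whose degree is one less than the exponent extracted. *)
Lemma pairing_entry_below n lam mu (i j : 'I_n) :
    (j <= i)%N -> (part lam i < part mu j)%N ->
  ucoef_diff (Grow lam i * grow mu j) (staircase n mu j) (staircase n lam i) = 0.
Proof.
move=> le_ji lt_lm.
have cancel (c : nat -> R) a b : (a <= b)%N ->
    linp [seq c k | k <- iota 1 b] / linp [seq c k | k <- iota 1 a]
    = linp [seq c k | k <- iota (1 + a) (b - a)].
  move=> le_ab; rewrite -{1}(subnKC le_ab) iotaD map_cat linp_cat.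
  by rewrite mulrC mulKr // linp_unit.
have -> : Grow lam i * grow mu j
    = linp ([seq beta k | k <- iota (1 + j) (i - j)]
         ++ [seq alpha k | k <- iota (1 + part lam i) ((part mu j).-1 - part lam i)]).
  have swap (x y z w : mpser R 1) : x * y * (z * w) = x * w * (z * y).
    by rewrite [z * w]mulrC mulrACA [y * z]mulrC.
  rewrite linp_cat -(cancel beta j i) // -(cancel alpha (part lam i) (part mu j).-1).
    exact: swap.
  by lia.
rewrite /ucoef_diff; case: ifP => // le_s; apply: ucoef_linp_high.
rewrite size_cat !size_map !size_iota; move: le_s; rewrite /staircase.
by have := ltn_ord i; lia.
Qed.

Lemma pairing_entry_above n lam mu (i j : 'I_n) :
    (staircase n mu j < staircase n lam i)%N ->
  ucoef_diff (Grow lam i * grow mu j) (staircase n mu j) (staircase n lam i) = 0.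
Proof. by move=> lt_s; rewrite /ucoef_diff leqNgt lt_s. Qed.

Lemma pairing_det n lam mu : (size lam <= n)%N -> (size mu <= n)%N ->
  \det (\matrix_(i < n, j < n)
      ucoef_diff (Grow lam i * grow mu j) (staircase n mu j) (staircase n lam i))
  = (lam == mu)%:R.
Proof.
move=> le_lam le_mu; case: eqVneq => [<- | ne_lm].
  rewrite det_trig.
    rewrite big1 // => i _; rewrite mxE /ucoef_diff leqnn subnn ucoef0M.
    by rewrite !ucoef0_linp_div mulr1.
  apply/is_trig_mxP => i j lt_ij; rewrite mxE pairing_entry_above //.
  exact: staircase_lt.
have [i ne_i] : exists i : 'I_n, part lam i != part mu i.
  apply/existsP; apply: contraT; rewrite negb_exists => /forallP eq_lm.
  case/eqP: ne_lm; apply: (staircase_inj le_lam le_mu) => i lt_i.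
  by have := eq_lm (Ordinal lt_i); rewrite negbK /staircase => /eqP /= ->.
case: (ltngtP (part lam i) (part mu i)) ne_i => // lt_i _.
  apply: (@det_zero_block _ _ _ i) => k j le_ik le_ji; rewrite mxE.
  rewrite pairing_entry_below ?(leq_trans le_ji) //.
  by rewrite (leq_ltn_trans (part_le lam le_ik)) // (leq_trans lt_i) // part_le.
(* Here the zero block has rows up to [i] and columns from [i] on; transposing brings it to the
   shape of [det_zero_block]. *)
rewrite -det_tr; apply: (@det_zero_block _ _ _ i) => j k le_ij le_ki.
rewrite !mxE pairing_entry_above // /staircase.
have := part_le mu le_ij; have := part_le lam le_ki.
by have := ltn_ord j; lia.
Qed.

End Duality.

Theorem theorem3p5 (R : comNzRingType) (alpha beta : nat -> R)
    (lam mu : intpart) :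
  hall (Gseries alpha beta lam) (gseries alpha beta mu) = (lam == mu)%:R.
Proof.
rewrite (@hall_det _ _ _ _ _ (maxn (size lam) (size mu))) ?leq_maxl ?leq_maxr //.
by rewrite pairing_det ?leq_maxl ?leq_maxr.
Qed.
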